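(* Let $s\in(0,1)$, let $\Omega\subset\mathbb{R}^n$ be a bounded open set with $C^{1,1}$ boundary and let $v:\mathbb{R}^n\to\mathbb{R}$ be locally bounded. Let $M=M(n,s,\Omega,v)>0$ be a constant such that every set $E\subset\mathbb{R}^{n+1}$ which is locally $s$-minimal in $\Omega^\infty$ with $E\setminus\Omega^\infty=\mathcal{S}g(v)\setminus\Omega^\infty$ satisfies $$\Omega\times(-\infty,-M]\subset E\cap\Omega^\infty\subset\Omega\times(-\infty,M]\quad\text{and}\quad E\setminus\big(\Omega\times[-M,M]\big)=\mathcal{S}g(v)\setminus\big(\Omega\times[-M,M]\big).$$ Let $k_0$ be the smallest integer with $k_0>M$, and let $F\subset\mathbb{R}^{n+1}$ be $s$-minimal in $\Omega^{k_0}$ with exterior data $$F\setminus\Omega^{k_0}=\mathcal{S}g(v)\setminus\Omega^{k_0}.$$ Then $F$ is $s$-minimal in $\Omega^k$ for every integer $k\geq k_0$, and hence $F$ is locally $s$-minimal in $\Omega^\infty$.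
   Context: $\Omega^k=\Omega\times(-k,k)$ and $\Omega^\infty=\Omega\times\mathbb{R}$, subsets of $\mathbb{R}^{n+1}$. $\mathcal{S}g(v)=\{(x,t)\in\mathbb{R}^{n+1} : t<v(x)\}$ is the subgraph of $v$. $v$ locally bounded means $\sup_{|x|\leq r}|v(x)|<\infty$ for every $r>0$. A constant $M$ with the property required in the claim always exists. All sets and functions are Lebesgue measurable; equalities and inclusions of sets are understood up to measure zero. In $\mathbb{R}^{n+1}$: for disjoint $A,B\subset\mathbb{R}^{n+1}$ put $\mathcal{L}_s(A,B)=\int_A\int_B\frac{dX\,dY}{|X-Y|^{n+1+s}}\in[0,\infty]$. For $E\subset\mathbb{R}^{n+1}$ and an open set $U\subset\mathbb{R}^{n+1}$, writing $E^c=\mathbb{R}^{n+1}\setminus E$, $$P_s(E,U)=\mathcal{L}_s(E\cap U,E^c\cap U)+\mathcal{L}_s(E\cap U,E^c\setminus U)+\mathcal{L}_s(E\setminus U,E^c\cap U).$$ $E$ is $s$-minimal in $U$ if $P_s(E,U)<\infty$ and $P_s(E,U)\leq P_s(F,U)$ for every $F\subset\mathbb{R}^{n+1}$ with $F\setminus U=E\setminus U$. $E$ is locally $s$-minimal in $U$ if it is $s$-minimal in every open set $U'\subset\subset U$, where $A\subset\subset B$ means that $\overline{A}$ is compact and $\overline{A}\subset B$. *)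

(* Defs.v *)
From HB Require Import structures.
From mathcomp Require Import all_boot all_order all_algebra.
From mathcomp Require Import all_classical all_reals all_analysis.

Set Implicit Arguments.
Unset Strict Implicit.
Unset Printing Implicit Defensive.

Import Order.TTheory GRing.Theory Num.Theory.
Import numFieldNormedType.Exports.

Local Open Scope classical_set_scope.
Local Open Scope ring_scope.

Definition rV_display : measure_display -> measure_display.
Proof. exact. Qed.

Section rV_measurable.
Variables (R : realType) (n : nat).

Let coors : 'I_n -> 'rV[R]_n -> measurableTypeR R := fun i x => x ord0 i.

Let rV_set0 : g_sigma_preimage coors set0.
Proof. exact: sigma_algebra0. Qed.

Let rV_setC A : g_sigma_preimage coors A -> g_sigma_preimage coors (~` A).
Proof. exact: sigma_algebraC. Qed.

Let rV_bigcup (F : _^nat) : (forall i, g_sigma_preimage coors (F i)) ->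
  g_sigma_preimage coors (\bigcup_i (F i)).
Proof. exact: sigma_algebra_bigcup. Qed.

(* The product sigma-algebra, generated by the coordinate functions. *)
HB.instance Definition _ :=
  @isMeasurable.Build (rV_display default_measure_display)
    'rV[R]_n (g_sigma_preimage coors) rV_set0 rV_setC rV_bigcup.

Lemma measurable_rV_coord (i : 'I_n) :
  measurable_fun [set: 'rV[R]_n] (fun x => x ord0 i : measurableTypeR R).
Proof.
move=> _ Y mY; rewrite setTI; apply: sub_sigma_algebra => /=.
rewrite -bigcup_seq/=; exists i => /=; first by rewrite mem_index_enum.
by exists Y => //; rewrite setTI.
Qed.

Lemma measurable_fun_rV d (T : measurableType d) (f : T -> 'rV[R]_n) :
  (forall i, measurable_fun [set: T] (fun t => f t ord0 i : measurableTypeR R)) ->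
  measurable_fun [set: T] f.
Proof.
move=> mf; apply: (measurability _ (erefl (@measurable _ 'rV[R]_n))).
move=> _ [Y] + <-; rewrite -bigcup_seq/= => -[i _ [B mB <-]].
by rewrite setTI -comp_preimage; apply: mf.
Qed.

End rV_measurable.

Section rV_lebesgue.
Variable R : realType.
Local Open Scope ereal_scope.

(* The point (p.1, p.2) of R^n * R, as a vector of R^(n+1). *)
Definition rV_snoc n (p : 'rV[R]_n * measurableTypeR R) : 'rV[R]_n.+1 :=
  \row_i (if unlift ord_max i is Some j then p.1 ord0 j else p.2).

Lemma measurable_rV_snoc n : measurable_fun setT (@rV_snoc n).
Proof.
apply: measurable_fun_rV => i; rewrite /rV_snoc.
case: (unliftP ord_max i) => [j|] ->.
- rewrite (_ : (fun _ => _) =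
      (fun x : 'rV[R]_n => x ord0 j : measurableTypeR R) \o fst); last first.
    by apply/funext => p /=; rewrite mxE liftK.
  by apply: measurableT_comp => //; exact: measurable_rV_coord.
- rewrite (_ : (fun _ => _) = snd)//.
  by apply/funext => p /=; rewrite mxE unlift_none.
Qed.

Definition rV_lebesgue_step n (mu : {measure set 'rV[R]_n -> \bar R}) :=
  pushforward (mu \x @lebesgue_measure R) (@rV_snoc n).

Section rV_lebesgue_step_measure.
Variables (n : nat) (mu : {measure set 'rV[R]_n -> \bar R}).


Let step0 : rV_lebesgue_step mu set0 = 0.
Proof. by rewrite /rV_lebesgue_step /pushforward preimage_set0 measure0. Qed.

Let step_ge0 A : 0 <= rV_lebesgue_step mu A.
Proof. exact: (measure_ge0 (mu \x @lebesgue_measure R)). Qed.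

Let step_sigma_additive : semi_sigma_additive (rV_lebesgue_step mu).
Proof.
move=> F mF tF mUF.
have mpre A : measurable A -> measurable (@rV_snoc n @^-1` A).
  by move=> mA; rewrite -[X in measurable X]setTI; exact: measurable_rV_snoc.
rewrite /rV_lebesgue_step /pushforward preimage_bigcup.
apply: (@measure_semi_sigma_additive _ _ _ (mu \x @lebesgue_measure R)).
- by move=> k; exact: mpre.
- apply/trivIsetP => /= i j _ _ ij; rewrite -preimage_setI.
  by move/trivIsetP : tF => /(_ _ _ _ _ ij) ->//; rewrite preimage_set0.
- by rewrite -preimage_bigcup; exact: mpre.
Qed.

HB.instance Definition _ := isMeasure.Build _ _ _ (rV_lebesgue_step mu)
  step0 step_ge0 step_sigma_additive.

End rV_lebesgue_step_measure.

(* Lebesgue measure on the Borel sets of R^n, as the n-fold product of the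
   one-dimensional Lebesgue measure. *)
Fixpoint rV_lebesgue n : {measure set 'rV[R]_n -> \bar R} :=
  if n is m.+1 then rV_lebesgue_step (rV_lebesgue m)
  else dirac (0%R : 'rV[R]_0).

End rV_lebesgue.

(* R^(n+1) is represented as R^n * R, with points written (x, t). *)
Definition pt_borel_lebesgue (R : realType) (n : nat) :
    set ('rV[R]_n * measurableTypeR R) -> \bar R :=
  (rV_lebesgue R n \x @lebesgue_measure R)%E.

HB.instance Definition _ (R : realType) (n : nat) :=
  Measure.on (@pt_borel_lebesgue R n).

(* The Lebesgue sigma-algebras: [rV_leb R n] and [pt_leb R n] are aliases of
   'rV[R]_n and 'rV[R]_n * R whose measurable sets are the Caratheodory
   measurable sets of the outer Lebesgue measure. *)
Notation rV_leb R n := (caratheodory_type (mu_ext (@rV_lebesgue R n))).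
Notation pt_leb R n := (caratheodory_type (mu_ext (@pt_borel_lebesgue R n))).

Definition pt_lebesgue (R : realType) (n : nat) : set (pt_leb R n) -> \bar R :=
  @completed_measure_extension _ _ _ (@pt_borel_lebesgue R n).

HB.instance Definition _ (R : realType) (n : nat) :=
  Measure.on (@pt_lebesgue R n).

Section lebesgue_sets.
Variables (R : realType) (n : nat).
Implicit Types A B : set ('rV[R]_n * R).

Definition leb_measurable A := measurable (A : set (pt_leb R n)).

Definition ae_sub A B := (@pt_lebesgue R n).-negligible (A `\` B).

Definition ae_eq_set A B := (@pt_lebesgue R n).-negligible (A `+` B).

End lebesgue_sets.

Section euclidean.
Variables (R : realType) (n : nat).

Definition rV_dot (x y : 'rV[R]_n) : R := \sum_i x ord0 i * y ord0 i.

(* The library norm on 'rV[R]_n and on products is the sup norm, which has the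
   same topology and the same bounded sets as the Euclidean norms below. *)
Definition rV_norm2 (x : 'rV[R]_n) : R := Num.sqrt (rV_dot x x).

Definition pt_norm2 (X : 'rV[R]_n * R) : R :=
  Num.sqrt (rV_dot X.1 X.1 + X.2 ^+ 2).

End euclidean.

Section C11.
Variables (R : realType) (n : nat).

Definition gradient (f : 'rV[R]_n -> R) (x : 'rV[R]_n) : 'rV[R]_n :=
  \row_i 'D_(delta_mx ord0 i) f x.

Definition C11 (f : 'rV[R]_n -> R) :=
  (forall x, differentiable f x) /\ [lipschitz gradient f x | x in setT].

(* Near every boundary point, Omega is the strict subgraph, in the direction of
   a unit vector nu, of a C^{1,1} function gam on the hyperplane orthogonal to
   nu. The function gam is given on the whole of R^n and evaluated at the
   orthogonal projection of x on that hyperplane, which avoids choosing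
   coordinates on it. *)
Definition C11_boundary (Omega : set 'rV[R]_n) :=
  forall x0, (closure Omega `\` interior Omega) x0 ->
  exists (r : R) (nu : 'rV[R]_n) (gam : 'rV[R]_n -> R),
    [/\ 0 < r, rV_norm2 nu = 1, C11 gam &
      forall x, rV_norm2 (x - x0) < r ->
        Omega x <-> rV_dot x nu < gam (x - rV_dot x nu *: nu)].

End C11.

Section fractional_perimeter.
Variables (R : realType) (n : nat) (s : R).
Implicit Types A B E F U : set ('rV[R]_n * R).

(* Only meant for disjoint A and B: on the diagonal X = Y the integrand is 0 by
   the convention 0^-1 = 0. *)
Definition interaction A B : \bar R :=
  (\int[@pt_lebesgue R n]_(X in A) \int[@pt_lebesgue R n]_(Y in B)
    ((pt_norm2 ((X : 'rV[R]_n * R) - Y) `^ (n.+1%:R + s))^-1)%:E)%E.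

Definition s_perimeter E U : \bar R :=
  (interaction (E `&` U) (~` E `&` U) + interaction (E `&` U) (~` E `\` U)
   + interaction (E `\` U) (~` E `&` U))%E.

(* The measurability of E and the openness of U are assumed where they are
   used; as everywhere, sets are compared up to null sets. *)
Definition s_minimal E U :=
  (s_perimeter E U < +oo)%E /\
  forall F, leb_measurable F -> ae_eq_set (F `\` U) (E `\` U) ->
    (s_perimeter E U <= s_perimeter F U)%E.

Definition compactly_contained A B := compact (closure A) /\ closure A `<=` B.

Definition locally_s_minimal E U :=
  forall U', open U' -> compactly_contained U' U -> s_minimal E U'.

End fractional_perimeter.

Section subgraph_cylinders.
Variables (R : realType) (n : nat).

Definition subgraph (v : 'rV[R]_n -> R) : set ('rV[R]_n * R) :=
  [set X | X.2 < v X.1].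

Definition locally_bounded (v : 'rV[R]_n -> R) :=
  forall r : R, 0 < r -> [bounded v x | x in [set x | rV_norm2 x <= r]].

Definition cylinder (Omega : set 'rV[R]_n) (k : R) : set ('rV[R]_n * R) :=
  Omega `*` `]-k, k[.

Definition infinite_cylinder (Omega : set 'rV[R]_n) : set ('rV[R]_n * R) :=
  Omega `*` setT.

(* The defining property of the constant M = M(n, s, Omega, v). *)
Definition height_bound (s : R) (Omega : set 'rV[R]_n) (v : 'rV[R]_n -> R)
    (M : R) :=
  forall E : set ('rV[R]_n * R), leb_measurable E ->
    locally_s_minimal s E (infinite_cylinder Omega) ->
    ae_eq_set (E `\` infinite_cylinder Omega)
              (subgraph v `\` infinite_cylinder Omega) ->
    [/\ ae_sub (Omega `*` `]-oo, -M]) (E `&` infinite_cylinder Omega),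
        ae_sub (E `&` infinite_cylinder Omega) (Omega `*` `]-oo, M]) &
        ae_eq_set (E `\` (Omega `*` `[-M, M]))
                  (subgraph v `\` (Omega `*` `[-M, M]))].

End subgraph_cylinders.

(* Main.v *)
(* Write Q_U(E) for the s-perimeter of E in U.  By the height bound it suffices
  to
   have one locally s-minimal set E in Omega x R with E = F outside Omega x R:
     then
   E = F outside Omega^k0, so Q(F) <= Q(E) in Omega^k0, hence in every larger
   cylinder, where E is minimal.

   Existence of E rests on the submodularity
   Q(E & F) + Q(E | F) <= Q(E) + Q(F), which replaces compactness twice.  It
     turns a
   minimizing sequence into a monotone one, so Fatou's lemma gives a minimizer
     in
   each Omega^k; and with exterior data empty in (Omega x R) \ Omega^k the union
     of
   the minimizers in Omega^k and Omega^(k+1) is again a minimizer in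
     Omega^(k+1).
   The resulting increasing sequence of minimizers converges to E.

   The energies are finite because Omega^k has finite s-perimeter: the C^{1,1}
   boundary has a layer of measure O(delta), and the kernel is summed over
     dyadic
   shells around the diagonal. *)

From HB Require Import structures.
Require Import Defs.
From mathcomp Require Import all_boot all_order all_algebra.
From mathcomp Require Import all_classical all_reals all_analysis.
From mathcomp Require Import measurable_realfun zify ring lra.
Import Order.TTheory GRing.Theory Num.Theory.
Import numFieldNormedType.Exports.
Local Open Scope classical_set_scope.
Local Open Scope ring_scope.

Set Implicit Arguments.
Unset Strict Implicit.
Unset Printing Implicit Defensive.

(** * Submodular minimization of a nonlocal perimeter *)

(** The perimeter is the integral of the kernel over the ordered pairs that are cut by the set and
    meet the window. Submodularity, enlargement of the window and lower semicontinuity thus become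
    statements about sets of pairs, valid for any measure on a product, and pointwise convergence of
    sets is enough.

    What shapes the construction of E is that the property defining M looks only at data outside
    Omega x R. The minimizers may therefore start from data deleted inside Omega x R. Such data are
    contained in every competitor for every window, and this nesting makes unions of successive
    minimizers minimal. That E has the right data at large heights is not arranged by hand: the
    height bound yields it, and M < k0 then confines the differences between E and F to Omega^k0, up
    to a null set.

    Over the infinite cylinder the perimeter may be infinite, so every cancellation is made in a
    bounded window. Finiteness there uses both bounds on s: the shells of radius 2^-j contribute
    2^(-j(1-s)), those of radius 2^j contribute 2^(-js). *)

Section set_integral.
Context d (T : measurableType d) (R : realType).
Variables (m : {measure set T -> \bar R}) (w : T -> \bar R).
Hypotheses (mw : measurable_fun setT w) (w0 : forall z, (0 <= w z)%E).
Local Open Scope ereal_scope.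
Implicit Types A B C D : set T.

Let mwS A : measurable_fun A w.
Proof. exact: measurable_funTS. Qed.

Lemma integral_setID A B : measurable A -> measurable B -> B `<=` A ->
  \int[m]_(z in A) w z = \int[m]_(z in B) w z + \int[m]_(z in A `\` B) w z.
Proof.
move=> mA mB BA; rewrite -[in LHS](setDUK BA) ge0_integral_setU//.
- exact: measurableD.
- by apply/disj_setPS => z [Bz [_]].
Qed.

(** The two inclusions say that 1_A + 1_B <= 1_C + 1_D pointwise. In this form no integral is
    subtracted, so infinite values are harmless. *)
Lemma le_integral_set_pair A B C D : measurable A -> measurable B ->
  measurable C -> measurable D -> A `|` B `<=` C `|` D -> A `&` B `<=` C `&` D
    ->
  \int[m]_(z in A) w z + \int[m]_(z in B) w z <=
  \int[m]_(z in C) w z + \int[m]_(z in D) w z.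
Proof.
move=> mA mB mC mD ABCDU ABCDI.
have UI X Y : measurable X -> measurable Y ->
    \int[m]_(z in X) w z + \int[m]_(z in Y) w z =
    \int[m]_(z in X `|` Y) w z + \int[m]_(z in X `&` Y) w z.
  move=> mX mY.
  rewrite (@integral_setID (X `|` Y) X)//; last exact: measurableU.
  rewrite setDUl setDv set0U -addeA; congr (_ + _).
  rewrite (@integral_setID Y (X `&` Y))//; last exact: measurableI.
  by rewrite addeC setDIr setDv setU0.
rewrite UI// [leRHS]UI//; apply: leeD.
- by apply: ge0_subset_integral => //; exact: measurableU.
- by apply: ge0_subset_integral => //; exact: measurableI.
Qed.

Lemma integral_subset_setU A B C : measurable A -> measurable B ->
  measurable C -> A `<=` B `|` C ->
  \int[m]_(z in A) w z <= \int[m]_(z in B) w z + \int[m]_(z in C) w z.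
Proof.
move=> mA mB mC ABC; rewrite -[leLHS]adde0 -(integral_set0 m w).
by apply: le_integral_set_pair => //; rewrite ?setU0 ?setI0.
Qed.

(** Fatou's lemma for indicators: A lies in the union of the increasing tail intersections [B_], to
    which monotone convergence applies. *)
Lemma integral_liminf_le (A_ : (set T)^nat) A (c : \bar R) :
  (forall j, measurable (A_ j)) -> measurable A ->
  (forall z, A z -> \forall j \near \oo, A_ j z) ->
  (\forall j \near \oo, \int[m]_(z in A_ j) w z <= c) ->
  \int[m]_(z in A) w z <= c.
Proof.
move=> mA_ mA AA [N _ Nc].
pose B_ k := \bigcap_(j >= k) A_ j.
have mB k : measurable (B_ k) by apply: bigcap_measurable => //; exists k => /=.
have ndB : nondecreasing_seq B_.
  move=> i j ij; apply/subsetPset => z Bz k /= jk; apply: Bz => /=.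
  exact: leq_trans ij jk.
have AB : A `<=` \bigcup_k B_ k.
  by move=> z /AA[k _ kA]; exists k => // j /= kj; apply: kA.
apply: (@le_trans _ _ (\int[m]_(z in \bigcup_k B_ k) w z)).
  by apply: ge0_subset_integral => //; exact: bigcup_measurable.
have cv := @ge0_nondecreasing_set_cvg_integral _ _ _ B_ w m ndB mB
  (fun=> @mwS _) (fun _ z _ => w0 z).
rewrite -(cvg_lim _ cv)//; apply: lime_le; first by apply/cvg_ex; eexists;
  exact: cv.
exists N => // k /= Nk; apply: le_trans (Nc k Nk).
by apply: ge0_subset_integral => // z; apply => /=.
Qed.

(** Continuity from above of the measure with density w. If every integral exceeded e, those over
    the complements in [A_ 0] would stay e below their limit, which is finite. *)
Lemma integral_nonincreasing_lt (A_ : (set T)^nat) (e : R) :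
  (forall j, measurable (A_ j)) -> nonincreasing_seq A_ ->
  \bigcap_j A_ j = set0 -> \int[m]_(z in A_ 0%N) w z < +oo -> (0 < e)%R ->
  exists j, \int[m]_(z in A_ j) w z <= e%:E.
Proof.
move=> mA niA A0 fin e0.
pose B_ k := A_ 0%N `\` A_ k.
have mB k : measurable (B_ k) by exact: measurableD.
have ndB : nondecreasing_seq B_.
  move=> i j ij; apply/subsetPset => z [Az nA]; split => //.
  by apply: contra_not nA; move: z {Az}; apply/subsetPset/niA.
have UB : \bigcup_k B_ k = A_ 0%N.
  apply/seteqP; split=> [z [k _ []]//|z Az].
  have [k nk] : exists k, ~ A_ k z.
    by apply/existsNP => all; have : (\bigcap_j A_ j) z by []; rewrite A0.
  by exists k.
have cv := @ge0_nondecreasing_set_cvg_integral _ _ _ B_ w m ndB mB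
  (fun=> @mwS _) (fun _ z _ => w0 z).
rewrite UB in cv.
apply: contrapT => /forallNP/= all.
have I0 k : 0 <= \int[m]_(z in A_ k) w z by apply: integral_ge0.
have fin0 : \int[m]_(z in A_ 0%N) w z \is a fin_num by rewrite ge0_fin_numE.
have : \int[m]_(z in A_ 0%N) w z <= \int[m]_(z in A_ 0%N) w z - e%:E.
  rewrite -{1}(cvg_lim _ cv)//; apply: lime_le; first by apply/cvg_ex; eexists;
    exact: cv.
  apply: nearW => k; rewrite leeBrDr//.
  rewrite (@integral_setID (A_ 0%N) (B_ k))//; last by move=> z [].
  rewrite leeD2l// /B_ setDD setIidr; last by apply/subsetPset/niA.
  by apply/ltW; rewrite ltNge; apply/negP/all.
by rewrite leNgt => /negP; apply; rewrite lteBlDr// lteDl// ?lte_fin.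
Qed.

End set_integral.

Section nonlocal_perimeter.
Context d (T : measurableType d) (R : realType).
Variables (m : {measure set (T * T) -> \bar R}) (K : T * T -> \bar R).
Hypotheses (mK : measurable_fun setT K) (K0 : forall z, (0 <= K z)%E).
Local Open Scope ereal_scope.
Implicit Types D E F G U V : set T.

(** The three interactions in the s-perimeter are taken over disjoint products whose union is this
    set. *)
Definition cut_pairs U E : set (T * T) :=
  [set z | [/\ E z.1, ~ E z.2 & U z.1 \/ U z.2]].

Definition nl_perimeter U E : \bar R := \int[m]_(z in cut_pairs U E) K z.

(** Exterior data are compared exactly and finiteness is kept apart; [s_minimal_nl] restores both
    null sets and finiteness. *)
Definition nl_minimal U E :=
  forall G, measurable G -> G `\` U = E `\` U -> nl_perimeter U E <=
    nl_perimeter U G.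

Lemma measurable_cut_pairs U E : measurable U -> measurable E ->
  measurable (cut_pairs U E).
Proof.
move=> mU mE.
rewrite (_ : cut_pairs U E = (E `*` ~` E) `&` ((U `*` setT) `|` (setT `*` U))).
  apply: measurableI; first by apply: measurableX => //; exact: measurableC.
  by apply: measurableU; exact: measurableX.
apply/seteqP; split=> [z [Ez nEz UU]|z [[Ez nEz] [[Uz _]|[_ Uz]]]]; split=> //.
- by case: UU => Uz; [left|right].
- by left.
- by right.
Qed.
Local Hint Resolve measurable_cut_pairs : core.

Lemma nl_perimeter_ge0 U E : 0 <= nl_perimeter U E.
Proof. by apply: integral_ge0 => z _. Qed.

(** A pair cut by the union or by the intersection is cut by E or by F. If it is cut by both, its
    first point lies in E and F and its second in neither, so E and F both cut it. *)
Lemma nl_perimeter_submod U E F : measurable U -> measurable E -> measurable F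
  ->
  nl_perimeter U (E `|` F) + nl_perimeter U (E `&` F) <=
  nl_perimeter U E + nl_perimeter U F.
Proof.
move=> mU mE mF.
have mEF : measurable (E `|` F) by exact: measurableU.
have mEIF : measurable (E `&` F) by exact: measurableI.
apply: le_integral_set_pair => //; try exact: measurable_cut_pairs.
- move=> z [[[Ez|Fz] nEF Uz]|[[Ez Fz] nEF Uz]].
  + by left; split=> //; apply: contra_not nEF; left.
  + by right; split=> //; apply: contra_not nEF; right.
  + by move/not_andP : nEF => [nE|nF]; [left|right].
- move=> z [[_ nU Uz] [[Ez Fz] _ _]].
  by split; split=> //; apply: contra_not nU; [left|right].
Qed.

Lemma nl_perimeter_lsc U (E_ : (set T)^nat) E (c : \bar R) : measurable U ->
  (forall j, measurable (E_ j)) -> measurable E ->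
  (forall x, E x -> \forall j \near \oo, E_ j x) ->
  (forall x, ~ E x -> \forall j \near \oo, ~ E_ j x) ->
  (\forall j \near \oo, nl_perimeter U (E_ j) <= c) -> nl_perimeter U E <= c.
Proof.
move=> mU mE_ mE EE NE Pc.
apply: (integral_liminf_le mK K0 (A_ := fun j => cut_pairs U (E_ j))) Pc.
- by move=> j; exact: measurable_cut_pairs.
- exact: measurable_cut_pairs.
- move=> z [/EE E1 /NE E2 Uz].
  by near=> j; split => //; near: j.
Unshelve. all: by end_near. Qed.

Lemma nl_perimeter_le_integral U E A : measurable U -> measurable E ->
  measurable A -> cut_pairs U E `<=` A ->
  nl_perimeter U E <= \int[m]_(z in A) K z.
Proof.
move=> mU mE mA sub; apply: ge0_subset_integral => //;
  first exact: measurable_cut_pairs.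
exact: measurable_funTS.
Qed.

(* Enlarging the window adds the same amount to the perimeters of two sets that
   agree off the smaller window. *)
Lemma nl_perimeter_widen U V E F : U `<=` V -> measurable U -> measurable V ->
  measurable E -> measurable F -> E `\` U = F `\` U ->
  exists r : \bar R, [/\ 0 <= r, nl_perimeter V E = nl_perimeter U E + r &
    nl_perimeter V F = nl_perimeter U F + r].
Proof.
move=> UV mU mV mE mF EF.
have EFx x : ~ U x -> E x <-> F x.
  move=> nU; split=> [Ex|Fx].
  - by have [] : (F `\` U) x by rewrite -EF.
  - by have [] : (E `\` U) x by rewrite EF.
have sub G : cut_pairs U G `<=` cut_pairs V G.
  by move=> z [? ? [/UV|/UV] ?]; split => //; [left|right].
exists (\int[m]_(z in cut_pairs V E `\` cut_pairs U E) K z); split.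
- by apply: integral_ge0 => z _.
- by apply: integral_setID => //; exact: measurable_cut_pairs.
- rewrite (_ : _ `\` _ = cut_pairs V F `\` cut_pairs U F).
    by apply: integral_setID => //; exact: measurable_cut_pairs.
  apply/seteqP; split=> z [[Gz nGz Vz] nU];
    have [nU1 nU2] : ~ U z.1 /\ ~ U z.2
      by split; apply: contra_not nU => Uz; split => //; [left|right].
  + split; first by split => //; [exact/EFx|by rewrite -(EFx _ nU2)].
    by case=> _ _ [].
  + split; first by split => //; [exact/EFx|by rewrite (EFx _ nU2)].
    by case=> _ _ [].
Qed.

(** A competitor in U is also one in V, and passing from U to V adds the same r to both perimeters.
    Finiteness in V bounds r and allows it to be cancelled. *)
Lemma nl_minimal_sub U V E : U `<=` V -> measurable U -> measurable V ->
  measurable E -> nl_perimeter V E < +oo -> nl_minimal V E -> nl_minimal U E.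
Proof.
move=> UV mU mV mE fin minE G mG GE.
have [r [r0 rG rE]] := nl_perimeter_widen UV mU mV mG mE GE.
have : nl_perimeter V E <= nl_perimeter V G.
  apply: minE => //; apply/seteqP; split=> x [Gx nV]; split=> //.
  - by have [] : (E `\` U) x by rewrite -GE; split=> // /UV.
  - by have [] : (G `\` U) x by rewrite GE; split=> // /UV.
rewrite rG rE leeD2rE// ge0_fin_numE//.
by apply: le_lt_trans fin; rewrite rE leeDr// nl_perimeter_ge0.
Qed.

Lemma nl_minimal_widen U V E F : U `<=` V -> measurable U -> measurable V ->
  measurable E -> measurable F -> E `\` U = F `\` U ->
  nl_minimal V E -> nl_minimal U F -> nl_minimal V F.
Proof.
move=> UV mU mV mE mF EF minE minF G mG GF.
have [r [r0 rE rF]] := nl_perimeter_widen UV mU mV mE mF EF.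
apply: (@le_trans _ _ (nl_perimeter V E)).
  by rewrite rE rF leeD2r//; exact: minF.
apply: minE => //; rewrite GF.
(* Off V the sets E and F agree because they already agree off the smaller U. *)
rewrite -(setUidr UV) setUC -!setDDl.
by rewrite setDDl setUC -setDDl -EF setDDl setUC -setDDl.
Qed.

(* No compactness is needed: submodularity turns a minimizing sequence
   [Q (E j) < inf + 2^-j] into unions of tails [Q (\bigcup_(i >= j) E i) <=
   inf + 2 * 2^-j], whose decreasing limit is a minimizer by Fatou. *)
Lemma nl_minimal_exists U D : measurable U -> measurable D ->
  exists E, [/\ measurable E, E `\` U = D `\` U & nl_minimal U E].
Proof.
move=> mU mD; set Q := nl_perimeter U.
pose S := [set G | measurable G /\ G `\` U = D `\` U].
pose mu0 := ereal_inf (Q @` S).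
have mu0Q G : S G -> mu0 <= Q G by move=> SG; apply: ereal_inf_lbound; exists G.
have SD : S D by [].
have mu0_ge0 : 0 <= mu0.
  by apply: le_ereal_inf_tmp => _ [G _ <-]; exact: nl_perimeter_ge0.
suff [E [mE ED] QE] : exists2 E, S E & Q E <= mu0.
  exists E; split=> // G mG GE; apply: (le_trans QE); apply: mu0Q.
  by split=> //; rewrite GE.
have [muoo|muoo] := eqVneq mu0 +oo; first by exists D => //; rewrite muoo leey.
have mufin : mu0 \is a fin_num by rewrite ge0_fin_numE// lt_neqAle muoo leey.
pose r := fine mu0.
have rE : mu0 = r%:E by rewrite fineK.
pose a j : R := (2^-1 ^+ j)%R.
have a0 j : (0 < a j)%R by rewrite exprn_gt0// invr_gt0.
have /choice[e Pe] j : exists G, S G /\ Q G <= (r + a j)%:E.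
  have [_ [G SG <-] QG] := lb_ereal_inf_adherent (a0 j) mufin.
  by exists G; split=> //; rewrite EFinD -rE; exact: ltW.
have SU F G : S F -> S G -> S (F `|` G).
  move=> [mF FD] [mG GD]; split; first exact: measurableU.
  by rewrite setDUl FD GD setUid.
have SI F G : S F -> S G -> S (F `&` G).
  move=> [mF FD] [mG GD]; split; first exact: measurableI.
  by rewrite setDE setIIl -!setDE FD GD setIid.
pose A j N := \big[setU/set0]_(i < N.+1) e (j + i)%N.
(* The correction [- a (j + N)] makes the induction close: by submodularity, adding the next set
   costs only [a (j + N.+1)], as the intersection is a competitor and has energy at least r, and
   [a (j + N)] is twice that cost. *)
have PA j N : S (A j N) /\ Q (A j N) <= (r + 2 * a j - a (j + N)%N)%:E.
  elim: N => [|N [SA QA]].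
    rewrite /A big_ord1 addn0; have [Se Qe] := Pe j; split=> //.
    by apply: (le_trans Qe); rewrite lee_fin; lra.
  have -> : A j N.+1 = A j N `|` e (j + N.+1)%N by rewrite /A big_ord_recr.
  have [Se Qe] := Pe (j + N.+1)%N; split; first exact: SU.
  have sub : Q (A j N `|` e (j + N.+1)%N) + r%:E <=
      (r + 2 * a j - a (j + N)%N)%:E + (r + a (j + N.+1)%N)%:E.
    apply: le_trans (leeD QA Qe).
    have [mA _] := SA; have [me _] := Se.
    apply: le_trans (nl_perimeter_submod mU mA me).
    by apply: leeD2l; rewrite -rE; apply: mu0Q; exact: SI.
  have := sub; rewrite -leeBrDr// => /le_trans; apply.
  rewrite lee_fin; have -> : a (j + N)%N = (2 * a (j + N.+1)%N)%R.
    by rewrite /a addnS exprS mulrA mulfV// mul1r.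
  by lra.
(* Lower semicontinuity is used twice: along the finite unions [A j N] increasing to [B j], then
   along the decreasing [B j]. *)
pose B j := \bigcup_(i >= j) e i.
have SB j : S (B j).
  split; first by apply: bigcup_measurable => i _; have [[]] := Pe i.
  apply/seteqP; split=> [x [[i _ eix] nU]|x Dx].
    by have [[_ <-] _] := Pe i.
  have [[_ ej] _] := Pe j; move: Dx; rewrite -ej => -[ejx nU].
  by split=> //; exists j => /=.
have QB j : Q (B j) <= (r + 2 * a j)%:E.
  have [mB _] := SB j.
  apply: (nl_perimeter_lsc mU (E_ := A j)) => //.
  - by move=> N; have [[]] := PA j N.
  - move=> x [i /= ji eix]; exists (i - j)%N => //= N /= ijN.
    rewrite /A -(bigcup_mkord _ (fun i => e (j + i)%N));
      exists (i - j)%N => //=.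
    by rewrite subnKC.
  - move=> x nB; apply: nearW => N; apply: contra_not nB.
    rewrite /A -(bigcup_mkord _ (fun i => e (j + i)%N)) => -[i _ eix].
    by exists (j + i)%N => //=; rewrite leq_addr.
  - apply: nearW => N; have [_ QA] := PA j N; apply: (le_trans QA).
    by rewrite lee_fin lerBlDr lerDl ltW.
have SBI : S (\bigcap_j B j).
  split; first by apply: bigcapT_measurable => j; have [] := SB j.
  apply/seteqP; split=> [x [Bx nU]|x Dx].
    by have [_ <-] := SB 0%N; split=> //; exact: Bx.
  split; last by case: Dx.
  by move=> j _; have [_ SBj] := SB j; move: Dx; rewrite -SBj => -[].
have [mBI _] := SBI.
exists (\bigcap_j B j) => //; rewrite rE.
apply/lee_addgt0Pr => eps eps0; rewrite -EFinD.
apply: (nl_perimeter_lsc mU (E_ := B)) => //.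
- by move=> j; have [] := SB j.
- by move=> x Bx; apply: nearW => j; exact: Bx.
- move=> x /existsNP[j /not_implyP[_ nB]]; exists j => // k /= jk.
  by apply: contra_not nB => -[i /= ki eix]; exists i => //=;
    exact: leq_trans ki.
- have half : (`|2^-1 : R| < 1)%R by rewrite ger0_norm// invf_lt1// ltr1n.
  have /cvgrPdist_lt/(_ _ eps0)[N _ NP] := cvg_geometric (2 : R) half.
  exists N => // j /= Nj; apply: (le_trans (QB j)); rewrite lee_fin lerD2l.
  have := NP j Nj; rewrite sub0r normrN => /ltW; apply: le_trans.
  exact: ler_norm.
Qed.

End nonlocal_perimeter.

(** * Minimizers in an increasing sequence of windows *)

Section nonlocal_exhaustion.
Context d (T : measurableType d) (R : realType).
Variables (m : {measure set (T * T) -> \bar R}) (K : T * T -> \bar R).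
Hypotheses (mK : measurable_fun setT K) (K0 : forall z, (0 <= K z)%E).
Local Open Scope ereal_scope.
Local Notation nl_perimeter := (nl_perimeter m K).
Local Notation nl_minimal := (nl_minimal m K).
Implicit Types D E F G U V : set T.

(** A competitor G of the union does not have the data of [E_ j], so it is replaced by [G_ j], equal
    to G in U and to [E_ j] off U. The extra cost is an interaction of U with the part of E outside
    U not yet reached by [E_ j]; it tends to 0 because U has finite interaction with its
    complement. *)
Lemma nl_minimal_bigcup U (E_ : (set T)^nat) : measurable U ->
  (forall j, measurable (E_ j)) -> nondecreasing_seq E_ ->
  \int[m]_(z in U `*` ~` U) K z < +oo ->
  (forall j, nl_minimal U (E_ j)) -> nl_minimal U (\bigcup_j E_ j).
Proof.
move=> mU mE_ ndE fin minE G mG GE; set E := \bigcup_j E_ j.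
have mE : measurable E by exact: bigcup_measurable.
have mUC : measurable (~` U) by exact: measurableC.
pose G_ j := (G `&` U) `|` (E_ j `\` U).
pose B_ j := U `*` (~` U `&` (E `\` E_ j)).
have mB j : measurable (B_ j).
  by apply: measurableX => //; apply: measurableI => //; exact: measurableD.
have mG_ j : measurable (G_ j).
  by apply: measurableU; [exact: measurableI|exact: measurableD].
have PE j : nl_perimeter U (E_ j) <=
    nl_perimeter U G + \int[m]_(z in B_ j) K z.
  apply: (@le_trans _ _ (nl_perimeter U (G_ j))).
    apply: minE => //; apply/seteqP; split=> x.
      by case=> -[[]|].
    by move=> [Ex nU]; split=> //; right.
  (* A pair cut by [G_ j] but not by G has its second point off U, in E but not in [E_ j]; since the
     pair meets U, its first point is in U. The empty set fills the fourth slot. *)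
  rewrite -[leLHS]adde0 -(integral_set0 m K).
  apply: le_integral_set_pair => //; [exact: measurable_cut_pairs| |
    |by move=> z [_ []]].
    exact: measurable_cut_pairs.
  move=> z [[GEz nGEz Uz]|//].
  have GEx x : ~ U x -> E x <-> G x.
    move=> nU; split=> [Ex|Gx].
    - by have [] : (G `\` U) x by rewrite GE.
    - by have [] : (E `\` U) x by rewrite -GE.
  have Gz1 : G z.1.
    by case: GEz => [[]//|[Ez nUz]]; apply/GEx => //; exists j.
  have [Uz2|nUz2] := pselect (U z.2).
    by left; split=> // Gz2; apply: nGEz; left.
  have [Ez2|nEz2] := pselect (E z.2); last by left; split=> //; rewrite -GEx.
  right; split; first by case: Uz.
  by split=> //; split=> // Ejz; apply: nGEz; right.
apply/lee_addgt0Pr => eps eps0.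
have niB : nonincreasing_seq B_.
  move=> i j ij; apply/subsetPset => z [Uz [nUz [Ez nEz]]]; split=> //;
    split=> //.
  by split=> //; apply: contra_not nEz; move: z.2; apply/subsetPset/ndE.
have B0 : \bigcap_j B_ j = set0.
  apply/seteqP; split=> // z Bz; have [_ [_ [[k _ Ekz] _]]] := Bz 0%N I.
  by have [_ [_ []]] := Bz k I.
have [N BN] : exists j, \int[m]_(z in B_ j) K z <= eps%:E.
  apply: integral_nonincreasing_lt => //; apply: le_lt_trans fin.
  apply: ge0_subset_integral => //; first exact: measurableX.
    exact: measurable_funTS.
  by move=> z [? []].
apply: (nl_perimeter_lsc mK K0 mU (E_ := E_)) => //.
- move=> x [k _ Ekx]; exists k => // j /= kj.
  by move: x Ekx; apply/subsetPset/ndE.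
- by move=> x nE; apply: nearW => j; apply: contra_not nE; exists j.
- exists N => // j /= Nj; apply: (le_trans (PE j)); apply: leeD2l.
  apply: le_trans BN; apply: ge0_subset_integral => //.
    exact: measurable_funTS.
  by apply/subsetPset/niB.
Qed.

(** As D misses all windows, one set D serves as exterior data for each of them. The finite unions
    [e k] of minimizers remain minimizers, increase with k, and their limit is minimal in every
    window. *)
Lemma nl_minimal_exhaustion (U_ : (set T)^nat) D :
  (forall k, measurable (U_ k)) -> nondecreasing_seq U_ -> measurable D ->
  D `&` \bigcup_k U_ k = set0 ->
  (forall k, \int[m]_(z in U_ k `*` ~` U_ k) K z < +oo) ->
  (forall k, \int[m]_(z in ~` U_ k `*` U_ k) K z < +oo) ->
  exists E, [/\ measurable E, E `\` \bigcup_k U_ k = D,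
    forall k, nl_perimeter (U_ k) E < +oo & forall k, nl_minimal (U_ k) E].
Proof.
move=> mU ndU mD DU finUC finCU.
have DUk k x : U_ k x -> ~ D x.
  move=> Ux Dx; suff : (D `&` \bigcup_k U_ k) x by rewrite DU.
  by split=> //; exists k.
have DD k : D `\` U_ k = D.
  by apply/seteqP; split=> [x []//|x Dx]; split=> // /DUk; apply.
have UU i j : (i <= j)%N -> U_ i `<=` U_ j by move=> ij; exact/subsetPset/ndU.
have mUC k : measurable (~` U_ k) by exact: measurableC.
(* D has no point in [U_ k], so a pair cut by D that meets the window has its second point there and
   its first outside. Comparison with D then bounds the energy of all minimizers with data D. *)
have finD k : nl_perimeter (U_ k) D < +oo.
  apply: le_lt_trans (finCU k); apply: nl_perimeter_le_integral => //.
    by apply: measurableX.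
  by move=> z [Dz nDz [/DUk//|Uz]]; split=> // /DUk; apply.
have /choice[g Pg] k : exists E,
    [/\ measurable E, E `\` U_ k = D & nl_minimal (U_ k) E].
  by have [E] := nl_minimal_exists m mK K0 (mU k) mD; rewrite DD => ?; exists E.
have mg k : measurable (g k) by have [] := Pg k.
pose e k := \big[setU/set0]_(i < k.+1) g i.
have eS k : e k.+1 = e k `|` g k.+1 by rewrite /e big_ord_recr.
have fin_min k E : measurable E -> E `\` U_ k = D -> nl_minimal (U_ k) E ->
    nl_perimeter (U_ k) E < +oo.
  move=> mE ED minE; apply: le_lt_trans (finD k).
  by apply: minE => //; rewrite ED DD.
have Pe k : [/\ measurable (e k), e k `\` U_ k = D & nl_minimal (U_ k) (e k)].
  elim: k => [|k [me eD mine]]; first by rewrite /e big_ord1.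
  have [mg' gD ming] := Pg k.+1; rewrite eS.
  set F := e k; set G := g k.+1; set U := U_ k.+1.
  have UkU : U_ k `<=` U by exact: UU.
  have mFG : measurable (F `&` G) by exact: measurableI.
  have mFUG : measurable (F `|` G) by exact: measurableU.
  have FU : F `\` U = D.
    by rewrite -(DD k.+1) -eD setDDl setUidr.
  have DG : D `<=` G by rewrite -gD => x [].
  (* Here the emptiness of the data in the windows enters: off [U_ k] the set F is just D, and G
     contains D. Hence the intersection is a competitor for F in the smaller window. *)
  have FGk : (F `&` G) `\` U_ k = F `\` U_ k.
    apply/seteqP; split=> x; first by move=> [[]].
    move=> [Fx nU]; split=> //; split=> //; apply: DG.
    by rewrite -eD; split.
  have [r [r0 rF rFG]] :=
    nl_perimeter_widen m mK K0 UkU (mU _) (mU _) me mFG (esym FGk).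
  have leFG : nl_perimeter U F <= nl_perimeter U (F `&` G).
    by rewrite rF rFG leeD2r//; exact: mine.
  have finF : nl_perimeter U F < +oo.
    have FD : F `\` U_ k = D `\` U_ k by rewrite DD.
    have [t [t0 tF tD]] := nl_perimeter_widen m mK K0 UkU (mU _) (mU _) me mD
      FD.
    rewrite tF; apply: lte_add_pinfty; first exact: fin_min.
    apply: le_lt_trans (finD k.+1); rewrite tD leeDr//.
    exact: nl_perimeter_ge0.
  have finG : nl_perimeter U G < +oo by exact: fin_min.
  have sub := nl_perimeter_submod m mK K0 (mU k.+1) me mg'.
  have finFG : nl_perimeter U (F `&` G) < +oo.
    apply: le_lt_trans (lte_add_pinfty finF finG).
    by apply: le_trans sub; rewrite leeDr// nl_perimeter_ge0.
  split=> //; first by rewrite setDUl FU gD setUid.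
  move=> H mH HFG.
  apply: (@le_trans _ _ (nl_perimeter U G)); last first.
    by apply: ming => //; rewrite HFG setDUl FU gD setUid.
  (* The energy of the intersection is finite and at least that of F, so submodularity leaves the
     energy of the union at most that of G. *)
  rewrite -(@leeD2rE _ (nl_perimeter U (F `&` G))); last first.
    by rewrite ge0_fin_numE// nl_perimeter_ge0.
  by apply: (le_trans sub); rewrite addeC leeD2l.
have nde : nondecreasing_seq e.
  by apply/nondecreasing_seqP => k; apply/subsetPset; rewrite eS; left.
have me k : measurable (e k) by have [] := Pe k.
pose E := \bigcup_k e k.
have mE : measurable E by exact: bigcup_measurable.
have ED k : E `\` U_ k `<=` D `|` (\bigcup_k U_ k).
  move=> x [[j _ ejx] _]; have [Ux|nUx] := pselect (U_ j x).
    by right; exists j.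
  by left; have [_ <- _] := Pe j.
have minE k : nl_minimal (U_ k) E.
  (* Dropping the first k terms leaves sets minimal in windows that contain [U_ k], hence minimal in
     [U_ k]. *)
  have -> : E = \bigcup_j e (k + j)%N.
    apply/seteqP; split=> [x [j _ ejx]|x [j _ ejx]]; last by exists (k + j)%N.
    by exists j => //; move: x ejx; apply/subsetPset/nde; rewrite leq_addl.
  apply: nl_minimal_bigcup => //.
    by move=> i j ij; apply: nde; rewrite leq_add2l.
  move=> j; have [_ eD mine] := Pe (k + j)%N.
  apply: (nl_minimal_sub mK K0 _ _ _ _ _ mine) => //.
    exact/UU/leq_addr.
  exact: fin_min.
exists E; split=> //.
- apply/seteqP; split=> [x [Ex nU]|x Dx].
    have : (D `|` \bigcup_k U_ k) x by apply: (ED 0%N); split=> // ?;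
      apply: nU; exists 0%N.
    by case.
  split; last by move=> [k _ /DUk].
  by exists 0%N => //; have [_ eD _] := Pe 0%N; move: Dx; rewrite -eD => -[].
(* E may differ from D off [U_ k], so D is no longer a competitor. Filling the window gives one: the
   pairs it cuts that meet the window go from [U_ k] to its complement. *)
- move=> k; apply: (@le_lt_trans _ _ (nl_perimeter (U_ k) (E `|` U_ k))).
    apply: minE; first exact: measurableU.
    by rewrite setDUl setDv setU0.
  apply: le_lt_trans (finUC k); apply: nl_perimeter_le_integral => //.
  + exact: measurableU.
  + by apply: measurableX.
  + move=> z [_ nEU Uz]; have nU : ~ U_ k z.2 by apply: contra_not nEU; right.
    by split=> //; case: Uz.
Qed.

End nonlocal_exhaustion.

(** * Lebesgue measure and the fractional kernel *)

Section lebesgue_translation.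
Variable R : realType.
Local Open Scope ereal_scope.

Lemma measurable_rV_shift n (a : 'rV[R]_n) :
  measurable_fun [set: 'rV[R]_n] (fun x : 'rV[R]_n => (x + a)%R).
Proof.
apply: measurable_fun_rV => i.
rewrite (_ : (fun _ => _) = (fun x : 'rV[R]_n => (x ord0 i : R) + a ord0 i)%R).
  by apply: measurable_funD => //; exact: measurable_rV_coord.
by apply/funext => x; rewrite mxE.
Qed.

Lemma measurable_preimage_rV_shift n (a : 'rV[R]_n) (A : set 'rV[R]_n) :
  measurable A -> measurable [set x : 'rV[R]_n | A (x + a)%R].
Proof. by move=> mA; rewrite -[X in measurable X]setTI;
  exact: measurable_rV_shift. Qed.

Lemma measurable_shift (b : R) :
  measurable_fun [set: measurableTypeR R] (fun x : measurableTypeR R => (x +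
    b)%R : measurableTypeR R).
Proof. exact: measurable_funD. Qed.

Lemma lebesgue_measure_shift (b : R) (A : set (measurableTypeR R)) : measurable
  A ->
  @lebesgue_measure R [set x : R | A (x + b)%R] = @lebesgue_measure R A.
Proof.
move=> mA; apply/esym.
apply: (lebesgue_measure_unique
  (mu := measure_function_pushforward__canonical__measure_function_Measure
    (@lebesgue_measure R) (measurable_shift b))) => //=.
move=> X /ocitvP[->|[[x y] /= xy ->]];
  first by rewrite /pushforward preimage_set0 !measure0.
rewrite /pushforward.
rewrite (_ : _ @^-1` _ = `](x - b)%R, (y - b)%R]%classic); last first.
  by apply/seteqP; split=> z /=; rewrite !in_itv/= ltrBlDr lerBrDr.
rewrite [LHS]lebesgue_measure_itv [RHS]lebesgue_measure_itv/= !lte_fin ltrD2r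
  xy.
by rewrite -!EFinB; congr EFin; ring.
Qed.

(** Induction on the dimension: the last coordinate is shifted inside each section by the
    one-dimensional case, the others by a change of variable in the outer integral. Translates of a
    boundary slab are counted with it below. *)
Lemma rV_lebesgue_shift n (a : 'rV[R]_n) (A : set 'rV[R]_n) : measurable A ->
  rV_lebesgue R n [set x : 'rV[R]_n | A (x + a)%R] = rV_lebesgue R n A.
Proof.
elim: n a A => [a A mA|n IHn a A mA].
  by congr (rV_lebesgue R 0 _); apply/seteqP; split=> x /=;
    rewrite (thinmx0 x) (thinmx0 a) addr0.
pose B : set ('rV[R]_n * measurableTypeR R) := @rV_snoc R n @^-1` A.
have mB : measurable B by rewrite -[B]setTI; exact: measurable_rV_snoc.
pose a1 : 'rV[R]_n := (\row_j a ord0 (lift ord_max j))%R.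
pose a2 : R := a ord0 ord_max.
pose B' : set ('rV[R]_n * measurableTypeR R) :=
  [set p | B ((p.1 + a1)%R, (p.2 + a2)%R)].
have snocD (p : 'rV[R]_n * measurableTypeR R) :
    rV_snoc ((p.1 + a1)%R, (p.2 + a2)%R) = (rV_snoc p + a)%R.
  apply/rowP => i; rewrite !mxE /=.
  by case: (unliftP ord_max i) => [j ->|->]; rewrite ?mxE.
rewrite /= /rV_lebesgue_step /pushforward.
have -> : @rV_snoc R n @^-1` [set x : 'rV[R]_n.+1 | A (x + a)%R] = B'.
  apply/seteqP; split=> p; rewrite /B' /B /preimage/= snocD //.
rewrite /product_measure1 -/B.
pose f x := @lebesgue_measure R (xsection B x).
have mf : measurable_fun setT f by exact: measurable_fun_xsection.
rewrite (_ : _ \o xsection B' = f \o (fun x => x + a1)%R); last first.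
  apply/funext => x /=; rewrite /f -[RHS](lebesgue_measure_shift a2);
    last first.
    exact: measurable_xsection.
  by congr (lebesgue_measure _); apply/seteqP; split=> y /=;
    rewrite /xsection/= !inE.
have pf := ge0_integral_pushforward (measurable_rV_shift a1) (rV_lebesgue R n)
  measurableT mf (fun x _ => measure_ge0 _ _).
rewrite preimage_setT in pf; rewrite -pf.
(* By the induction hypothesis the measure pushed forward by the shift is the measure itself. *)
apply: (@eq_measure_integral _ _ _ _ (rV_lebesgue R n)
  (measure_function_pushforward__canonical__measure_function_Measure
    (rV_lebesgue R n) (measurable_rV_shift a1))).
by move=> C mC _; exact: IHn.
Qed.

End lebesgue_translation.

(** For a countable dense family c this is second countability. With rational centres it makes open
    sets measurable for the product sigma-algebra, which is generated by coordinates and not by the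
    topology. *)
Lemma open_bigcup_ball (R : realType) (V : pseudoMetricType R) (I : Type)
    (c : I -> V) :
  (forall x (e : R), 0 < e -> exists q, ball x e (c q)) ->
  forall O : set V, open O -> O = \bigcup_(p in [set p : I * nat |
    ball (c p.1) p.2.+1%:R^-1 `<=` O]) ball (c p.1) p.2.+1%:R^-1.
Proof.
move=> dc O oO; apply/seteqP; split=> [x Ox|x [p pO px]]; last exact: pO.
have [e e0 eO] : exists2 e : R, 0 < e & ball x e `<=` O.
  by apply/nbhs_ballP; exact: open_nbhs_nbhs.
have e20 : 0 < e / 2 by rewrite divr_gt0.
pose k := Num.truncn (e / 2)^-1.
have ke : k.+1%:R^-1 < e / 2.
  by rewrite invf_plt ?posrE// /k truncnS_gt.
have k0 : 0 < k.+1%:R^-1 :> R by rewrite invr_gt0.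
have [q xq] := dc x _ k0.
exists (q, k) => /=; last exact: ball_sym.
move=> y qy; apply: eO; rewrite (splitr e).
by apply: ball_triangle; apply: le_ball;
  [exact: ltW ke|exact: xq|exact: ltW ke|].
Qed.

Section lebesgue_balls.
Variable R : realType.

Lemma rV_ballE n (c : 'rV[R]_n) (r : R) : 0 < r ->
  ball c r = [set x : 'rV[R]_n | forall i, `|c ord0 i - x ord0 i| < r].
Proof.
move=> r0; apply/seteqP; split=> x /=.
  by move=> [_ h] i; exact: h.
by move=> h; split=> // i j; rewrite (ord1 i); exact: h.
Qed.

Lemma measurable_rV_ball n (c : 'rV[R]_n) (r : R) : measurable (ball c r : set
  'rV[R]_n).
Proof.
have [r0|r0] := ltP 0 r; last first.
  by rewrite (_ : ball c r = set0)//; apply/seteqP; split=> // x [/lt_geF];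
    rewrite r0.
rewrite (rV_ballE c r0).
rewrite (_ : [set _ | _] = \bigcap_(i in [set: 'I_n])
    ((fun x : 'rV[R]_n => x ord0 i : measurableTypeR R) @^-1` ball (c ord0 i)
      r)); last first.
  by apply/seteqP; split=> [x h i _|x h i]; exact: h.
apply: fin_bigcap_measurable => // i _; rewrite -[X in measurable X]setTI.
by apply: measurable_rV_coord => //; exact: measurable_ball.
Qed.

Lemma rV_lebesgue_ball n (c : 'rV[R]_n) (r : R) : 0 < r ->
  rV_lebesgue R n (ball c r) = ((r *+ 2) ^+ n)%:E.
Proof.
move=> r0; elim: n c => [c|n IHn c].
  by rewrite /= diracE mem_set// (rV_ballE _ r0) => -[].
pose c1 : 'rV[R]_n := \row_j c ord0 (lift ord_max j).
rewrite /= /rV_lebesgue_step /pushforward.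
rewrite (_ : _ @^-1` _ = ball c1 r `*` ball (c ord0 ord_max) r); last first.
  rewrite !rV_ballE//; apply/seteqP; split=> p /=.
    move=> h; split=> [j|].
      by have := h (lift ord_max j); rewrite !mxE liftK.
    by have := h ord_max; rewrite mxE unlift_none.
  move=> [h1 h2] i; rewrite mxE; case: (unliftP ord_max i) => [j ->|->]//.
  by have := h1 j; rewrite mxE.
rewrite product_measure1E//; last 2 first.
- exact: measurable_rV_ball.
- exact: measurable_ball.
rewrite exprSr EFinM; congr (_ * _)%E; first exact: IHn.
exact/lebesgue_measure_ball/ltW.
Qed.

Lemma open_rV_measurable n (O : set 'rV[R]_n) : open O -> measurable O.
Proof.
move=> oO.
rewrite (@open_bigcup_ball R 'rV[R]_n 'rV[rat]_n (fun q => map_mx ratr q) _ O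
  oO).
  rewrite bigcup_mkcond; apply: countable_bigcupT_measurable => //.
  move=> p; case: ifPn => _; [exact: measurable_rV_ball|exact: measurable0].
move=> x e e0; rewrite (rV_ballE _ e0).
have /choice[q qP] i : exists q : rat, `|x ord0 i - ratr q| < e.
  have /rat_in_itvoo[q] : x ord0 i - e < x ord0 i + e by rewrite ltrD2l gtrN.
  rewrite in_itv/= => /andP[h1 h2]; exists q.
  by rewrite distrC ltr_norml; apply/andP; split; lra.
by exists (\row_i q i) => i; rewrite !mxE.
Qed.

Lemma pt_ballE n (c : 'rV[R]_n * R) (r : R) : ball c r = ball c.1 r `*` ball c.2
  r.
Proof. by []. Qed.

Lemma open_pt_measurable n (O : set ('rV[R]_n * R)) : open O ->
  measurable (O : set ('rV[R]_n * measurableTypeR R)).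
Proof.
move=> oO.
rewrite (@open_bigcup_ball R ('rV[R]_n * R)%type ('rV[rat]_n * rat)%type
  (fun q => (map_mx ratr q.1 : 'rV[R]_n, ratr q.2 : R)) _ O oO).
  rewrite bigcup_mkcond; apply: countable_bigcupT_measurable => //.
  move=> p; case: ifPn => _; last exact: measurable0.
  apply: measurableX; [exact: measurable_rV_ball|exact: measurable_ball].
move=> [x t] e e0; rewrite /ball/= /prod_ball/= (rV_ballE _ e0).
have ratP (y : R) : exists q : rat, `|y - ratr q| < e.
  have /rat_in_itvoo[q] : y - e < y + e by rewrite ltrD2l gtrN.
  rewrite in_itv/= => /andP[h1 h2]; exists q.
  by rewrite distrC ltr_norml; apply/andP; split; lra.
have /choice[q qP] i := ratP (x ord0 i).
have [q2 q2P] := ratP t.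
by exists (\row_i q i, q2); split=> //= i; rewrite !mxE.
Qed.

Lemma pt_borel_lebesgueX n (A : set 'rV[R]_n) (B : set (measurableTypeR R)) :
  measurable A -> measurable B ->
  @pt_borel_lebesgue R n (A `*` B) = (rV_lebesgue R n A * @lebesgue_measure R
    B)%E.
Proof. by move=> mA mB; exact: product_measure1E. Qed.

Lemma pt_borel_lebesgue_sigma_finite n :
  sigma_finite [set: 'rV[R]_n * measurableTypeR R] (@pt_borel_lebesgue R n).
Proof.
exists (fun k => ball (0 : 'rV[R]_n) k.+1%:R `*` ball (0 : R) k.+1%:R).
  apply/esym/seteqP; split=> // -[x t] _.
  pose b := `|x| + `|t|; exists (Num.truncn b) => //.
  have bk : b < (Num.truncn b).+1%:R by exact: truncnS_gt.
  split=> /=; rewrite -ball_normE/= sub0r normrN; apply: le_lt_trans bk.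
    by rewrite lerDl.
  by rewrite lerDr.
move=> k; split.
  by apply: measurableX; [exact: measurable_rV_ball|exact: measurable_ball].
rewrite pt_borel_lebesgueX; [|exact: measurable_rV_ball|exact: measurable_ball].
by rewrite rV_lebesgue_ball// lebesgue_measure_ball// -EFinM ltry.
Qed.

Lemma pt_lebesgue_sigma_finite n :
  sigma_finite [set: pt_leb R n] (@pt_lebesgue R n).
Proof.
exact: (completed_measure_extension_sigma_finite (pt_borel_lebesgue_sigma_finite
  n)).
Qed.

Lemma pt_borel_leb_measurable n (A : set ('rV[R]_n * measurableTypeR R)) :
  measurable A -> leb_measurable A.
Proof. exact: caratheodory_measurable_mu_ext. Qed.

Lemma pt_lebesgue_borel n (A : set ('rV[R]_n * measurableTypeR R)) :
  measurable A -> @pt_lebesgue R n A = @pt_borel_lebesgue R n A.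
Proof. exact: measurable_mu_extE. Qed.

End lebesgue_balls.

HB.instance Definition _ (R : realType) (n : nat) :=
  Measure_isSigmaFinite.Build _ _ _ (@pt_lebesgue R n)
    (@pt_lebesgue_sigma_finite R n).

Section fractional_kernel.
Context (R : realType) (n : nat) (s : R).
Implicit Types A B E F G U : set (pt_leb R n).

Definition pt_kernel (z : pt_leb R n * pt_leb R n) : \bar R :=
  ((pt_norm2 ((z.1 : 'rV[R]_n * R) - z.2) `^ (n.+1%:R + s))^-1)%:E.

Definition pt_lebesgue2 := (@pt_lebesgue R n \x @pt_lebesgue R n)%E.

HB.instance Definition _ := Measure.on pt_lebesgue2.

Lemma pt_lebesgue2X A B : leb_measurable A -> leb_measurable B ->
  pt_lebesgue2 (A `*` B) = (@pt_lebesgue R n A * @pt_lebesgue R n B)%E.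
Proof. by move=> mA mB; exact: product_measure1E. Qed.

Lemma measurable_pt_coord (i : 'I_n) :
  measurable_fun [set: pt_leb R n] (fun X => (X : 'rV[R]_n * R).1 ord0 i : R).
Proof.
move=> _ Y mY; rewrite setTI; apply: pt_borel_leb_measurable.
rewrite (_ : _ @^-1` _ = ((fun x : 'rV[R]_n => x ord0 i : measurableTypeR R)
  @^-1` Y) `*` setT).
  apply: measurableX => //; rewrite -[X in measurable X]setTI.
  exact: measurable_rV_coord.
by apply/seteqP; split=> [X ?|X []].
Qed.

Lemma measurable_pt_snd :
  measurable_fun [set: pt_leb R n] (fun X => (X : 'rV[R]_n * R).2 : R).
Proof.
move=> _ Y mY; rewrite setTI; apply: pt_borel_leb_measurable.
rewrite (_ : _ @^-1` _ = setT `*` Y); first exact: measurableX.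
by apply/seteqP; split=> [X ?|X []].
Qed.

Lemma measurable_pt_kernel : measurable_fun setT pt_kernel.
Proof.
apply/measurable_EFinP.
rewrite (_ : (fun _ => _) = (fun z : pt_leb R n * pt_leb R n =>
  ((\sum_i (((z.1 : 'rV[R]_n * R).1 ord0 i : R) - (z.2 : 'rV[R]_n * R).1 ord0 i)
    ^+ 2 +
   (((z.1 : 'rV[R]_n * R).2 : R) - (z.2 : 'rV[R]_n * R).2) ^+ 2) `^ 2^-1)
     `^ (- (n.+1%:R + s)))); last first.
  apply/funext => z; rewrite /pt_norm2 powRN powR12_sqrt; last first.
    by rewrite addr_ge0 ?sqr_ge0// sumr_ge0// => i _; rewrite sqr_ge0.
  congr ((Num.sqrt (_ + _) `^ _)^-1).
  by apply: eq_bigr => i _; rewrite !mxE expr2.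
apply: (measurableT_comp (measurable_powR _)) => //.
apply: (measurableT_comp (measurable_powR _)) => //.
apply: measurable_funD; last first.
  apply: measurable_funX; apply: measurable_funB.
    exact: (measurableT_comp measurable_pt_snd measurable_fst).
  exact: (measurableT_comp measurable_pt_snd measurable_snd).
apply: measurable_sum => i; apply: measurable_funX; apply: measurable_funB.
  exact: (measurableT_comp (measurable_pt_coord i) measurable_fst).
exact: (measurableT_comp (measurable_pt_coord i) measurable_snd).
Qed.

Lemma pt_kernel_ge0 z : (0 <= pt_kernel z)%E.
Proof. by rewrite lee_fin invr_ge0 powR_ge0. Qed.

Lemma pt_kernelC X Y : pt_kernel (X, Y) = pt_kernel (Y, X).
Proof.
rewrite /pt_kernel/= /pt_norm2/= /rV_dot; congr ((Num.sqrt (_ + _) `^ _)^-1)%:E.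
  by apply: eq_bigr => i _; rewrite !mxE -mulrNN !opprB.
by rewrite -sqrrN opprB.
Qed.

Lemma interactionE A B : leb_measurable A -> leb_measurable B ->
  interaction s A B = (\int[pt_lebesgue2]_(z in A `*` B) pt_kernel z)%E.
Proof.
move=> mA mB; rewrite [RHS]integral_mkcond.
have mAB : measurable (A `*` B).
  exact: measurableX.
have mK : measurable_fun setT (pt_kernel \_ (A `*` B)).
  by apply/(measurable_restrictT _ mAB); apply: measurable_funTS;
    exact: measurable_pt_kernel.
have K0 z : (0 <= (pt_kernel \_ (A `*` B)) z)%E.
  by apply: erestrict_ge0 => ? _; exact: pt_kernel_ge0.
rewrite (fubini_tonelli1 _ mK K0).
rewrite /interaction [LHS]integral_mkcond; congr (integral _ _ _);
  apply/funext => X.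
rewrite /fubini_F patchE; case: ifPn => [|] XA.
  rewrite [LHS]integral_mkcond; congr (integral _ _ _); apply/funext => Y.
  rewrite !patchE; case: ifPn => YB.
    by rewrite mem_set//; split; exact/set_mem.
  by rewrite memNset// => -[_] /= /mem_set; rewrite (negbTE YB).
rewrite integral0_eq// => Y _; rewrite patchE memNset// => -[/= /mem_set].
by rewrite (negbTE XA).
Qed.

(** Tonelli in the other order and the symmetry of the kernel. One estimate thus covers the pairs
    leaving a window and those entering it. *)
Lemma interactionC A B : leb_measurable A -> leb_measurable B ->
  interaction s A B = interaction s B A.
Proof.
move=> mA mB; rewrite interactionE// integral_mkcond.
have mAB : measurable (A `*` B).
  exact: measurableX.
have mK : measurable_fun setT (pt_kernel \_ (A `*` B)).
  by apply/(measurable_restrictT _ mAB); apply: measurable_funTS;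
    exact: measurable_pt_kernel.
have K0 z : (0 <= (pt_kernel \_ (A `*` B)) z)%E.
  by apply: erestrict_ge0 => ? _; exact: pt_kernel_ge0.
rewrite (fubini_tonelli2 _ mK K0).
rewrite /interaction [RHS]integral_mkcond; congr (integral _ _ _);
  apply/funext => Y.
rewrite /fubini_G patchE; case: ifPn => [|] YB.
  rewrite [RHS]integral_mkcond; congr (integral _ _ _); apply/funext => X.
  rewrite !patchE; case: ifPn => [/set_mem[/= XA _]|XA].
    by rewrite (mem_set XA) pt_kernelC.
  rewrite memNset// => AX; case/negP: XA; apply/mem_set; split=> //.
  exact: set_mem YB.
rewrite integral0_eq// => X _; rewrite patchE memNset// => -[/= _ /mem_set].
by rewrite (negbTE YB).
Qed.

Lemma s_perimeterE E U : leb_measurable E -> leb_measurable U ->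
  s_perimeter s E U = nl_perimeter pt_lebesgue2 pt_kernel U E.
Proof.
move=> mE mU; rewrite /s_perimeter.
have mEC : leb_measurable (~` E) by exact: measurableC.
have m1 : leb_measurable (E `&` U) by exact: measurableI.
have m2 : leb_measurable (E `\` U) by exact: measurableD.
have m3 : leb_measurable (~` E `&` U) by exact: measurableI.
have m4 : leb_measurable (~` E `\` U) by exact: measurableD.
rewrite !interactionE//.
have mw D : measurable_fun D pt_kernel by apply: measurable_funTS;
  exact: measurable_pt_kernel.
have mX1 : measurable ((E `&` U) `*` (~` E `&` U)) by exact: measurableX.
have mX2 : measurable ((E `&` U) `*` (~` E `\` U)) by exact: measurableX.
have mX3 : measurable ((E `\` U) `*` (~` E `&` U)) by exact: measurableX.
have K0 D z : D z -> (0 <= pt_kernel z)%E by move=> _; exact: pt_kernel_ge0.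
rewrite -(ge0_integral_setU _ mX1 mX2 (mw _) (@K0 _)); last first.
  by apply/disj_setPS => z [[[_ _] [_ Uz]] [_ [_ /(_ Uz)]]].
rewrite -(ge0_integral_setU _ (measurableU _ _ mX1 mX2) mX3 (mw _) (@K0 _));
  last first.
  by apply/disj_setPS => z [[|] [[_ Uz] _] [[_ /(_ Uz)]]].
rewrite /nl_perimeter; congr (integral _ _ _); apply/seteqP; split=> z.
  by case=> [[]|] [[Ez Uz] [nEz Uz2]]; split=> //; [left|left|right].
move=> [Ez nEz Uz]; have [U1|U1] := pselect (U z.1).
  by left; have [U2|U2] := pselect (U z.2); [left|right].
by right; case: Uz => // Uz; split.
Qed.

Lemma ae_eq_set_sym E F : ae_eq_set E F -> ae_eq_set F E.
Proof. by rewrite /ae_eq_set setYC. Qed.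

Lemma ae_eq_set_trans E F G : ae_eq_set E F -> ae_eq_set F G -> ae_eq_set E G.
Proof.
move=> EF FG; apply: negligibleS (negligibleU EF FG) => x.
move=> [[Ex nGx]|[Gx nEx]]; have [Fx|nFx] := pselect (F x).
- by right; left.
- by left; left.
- by left; right.
- by right; right.
Qed.

(** If N is a null set containing the difference, the pairs with a point in N form a null set of the
    product, and off it E and F cut the same pairs. *)
Lemma nl_perimeter_ae U E F : leb_measurable U -> leb_measurable E ->
  leb_measurable F -> ae_eq_set E F ->
  nl_perimeter pt_lebesgue2 pt_kernel U E =
  nl_perimeter pt_lebesgue2 pt_kernel U F.
Proof.
move=> mU mE mF [N [mN muN EFN]].
have N0 : @pt_lebesgue R n N = 0%E by exact: muN.
pose M : set (pt_leb R n * pt_leb R n) := (N `*` setT) `|` (setT `*` N).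
have mw D : measurable_fun D pt_kernel by apply: measurable_funTS;
  exact: measurable_pt_kernel.
have mM : measurable M by apply: measurableU; exact: measurableX.
have M0 : pt_lebesgue2 M = 0%E.
  have mT : leb_measurable [set: pt_leb R n] by exact: measurableT.
  have NT : pt_lebesgue2 (N `*` setT) = 0%E by rewrite pt_lebesgue2X// N0 mul0e.
  have TN : pt_lebesgue2 (setT `*` N) = 0%E by rewrite pt_lebesgue2X// N0 mule0.
  by rewrite -[RHS]NT; apply: measureU0 => //; exact: measurableX.
have EFx x : ~ N x -> E x <-> F x.
  move=> nN; split=> [Ex|Fx]; apply: contrapT => nx; apply: nN; apply: EFN.
    by left.
  by right.
have K0 D z : D z -> (0 <= pt_kernel z)%E by move=> _; exact: pt_kernel_ge0.
rewrite /nl_perimeter.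
rewrite (ge0_negligible_integral mM (measurable_cut_pairs mU mE) (mw _) (@K0 _)
  M0).
rewrite (ge0_negligible_integral mM (measurable_cut_pairs mU mF) (mw _) (@K0 _)
  M0).
congr (integral _ _ _); apply/seteqP; split=> z [[Ez nEz Uz] nM];
  have [nN1 nN2] : ~ N z.1 /\ ~ N z.2
    by split=> Nz; apply: nM; [left|right].
- split=> //; split=> //; first exact/EFx.
  by rewrite -(EFx _ nN2).
- split=> //; split=> //; first exact/EFx.
  by rewrite (EFx _ nN2).
Qed.

End fractional_kernel.

(** * Finite fractional perimeter of the cylinders *)

Section shells.
Context (R : realType) (n : nat).
Implicit Types (U S : set (pt_leb R n)).

Local Notation pball := (@ball R ('rV[R]_n * R)%type).

Lemma pt_lebesgue_ball (X : 'rV[R]_n * R) (r : R) : 0 < r ->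
  @pt_lebesgue R n (ball X r) = ((r *+ 2) ^+ n.+1)%:E.
Proof.
move=> r0; rewrite pt_ballE.
have mB1 : measurable (ball X.1 r : set 'rV[R]_n) by exact: measurable_rV_ball.
have mB2 : measurable (ball X.2 r : set (measurableTypeR R)) by exact:
  measurable_ball.
rewrite pt_lebesgue_borel; last exact: measurableX.
rewrite pt_borel_lebesgueX// rV_lebesgue_ball// exprSr EFinM; congr (_ * _)%E.
exact/lebesgue_measure_ball/ltW.
Qed.

Lemma measurable_pt_tube (r : R) :
  measurable [set z : pt_leb R n * pt_leb R n | pball z.1 r z.2].
Proof.
have [r0|r0] := ltP 0 r; last first.
  rewrite (_ : [set _ | _] = set0)//; apply/seteqP; split=> // z [_ h].
  have : 0 < r by apply: le_lt_trans h; exact: normr_ge0.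
  by move/lt_geF; rewrite r0.
have mlt (f g : pt_leb R n -> R) : measurable_fun setT f -> measurable_fun setT
  g ->
    measurable [set z : pt_leb R n * pt_leb R n | `|f z.1 - g z.2| < r].
  move=> mf mg.
  have mh : measurable_fun setT (fun z : pt_leb R n * pt_leb R n => `|f z.1 - g
    z.2|).
    apply: measurableT_comp => //; apply: measurable_funB.
      exact: (measurableT_comp mf measurable_fst).
    exact: (measurableT_comp mg measurable_snd).
  have := mh measurableT _ (measurable_itv `]-oo, r[); rewrite setTI.
  by congr measurable; apply/seteqP; split=> z /=; rewrite in_itv.
rewrite (_ : [set _ | _] =
  (\bigcap_(i in [set: 'I_n]) [set z : pt_leb R n * pt_leb R n |
    `|(z.1 : 'rV[R]_n * R).1 ord0 i - (z.2 : 'rV[R]_n * R).1 ord0 i| < r]) `&`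
  [set z : pt_leb R n * pt_leb R n |
    `|(z.1 : 'rV[R]_n * R).2 - (z.2 : 'rV[R]_n * R).2| < r]); last first.
  apply/seteqP; split=> z; rewrite /= pt_ballE rV_ballE//.
    by move=> [h1 h2]; split=> // i _; exact: h1.
  by move=> [h1 h2]; split=> // i; exact: h1.
apply: measurableI.
  apply: fin_bigcap_measurable => // i _.
  by apply: (mlt (fun X => (X : 'rV[R]_n * R).1 ord0 i) (fun X => (X : 'rV[R]_n
    * R).1 ord0 i));
    exact: measurable_pt_coord.
by apply: (mlt (fun X => (X : 'rV[R]_n * R).2) (fun X => (X : 'rV[R]_n * R).2));
  exact: measurable_pt_snd.
Qed.

Lemma measurable_pt_tube_over S (r : R) : leb_measurable S ->
  measurable [set z : pt_leb R n * pt_leb R n | S z.1 /\ pball z.1 r z.2].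
Proof.
move=> mS; rewrite (_ : [set _ | _] = (S `*` setT) `&`
  [set z : pt_leb R n * pt_leb R n | pball z.1 r z.2]).
  by apply: measurableI; [exact: measurableX|exact: measurable_pt_tube].
by apply/seteqP; split=> [z []//|z [[]]].
Qed.

Lemma pt_lebesgue2_tube S (r : R) : 0 < r -> leb_measurable S ->
  pt_lebesgue2 [set z | S z.1 /\ pball z.1 r z.2] =
  (((r *+ 2) ^+ n.+1)%:E * @pt_lebesgue R n S)%E.
Proof.
move=> r0 mS; rewrite /pt_lebesgue2 /product_measure1.
transitivity (\int[@pt_lebesgue R n]_(X in S) ((r *+ 2) ^+ n.+1)%:E)%E;
  last first.
  exact: integral_cst.
rewrite [RHS]integral_mkcond; congr (integral _ _ _); apply/funext => X /=.
rewrite patchE; case: ifPn => [/set_mem SX|SX].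
  rewrite -(pt_lebesgue_ball X r0); congr (pt_lebesgue _).
  by apply/seteqP; split=> Y; rewrite /xsection/= inE/=; [case|split].
rewrite (_ : xsection _ _ = set0) ?measure0//.
apply/seteqP; split=> // Y; rewrite /xsection/= inE/= => -[SX' _].
by rewrite mem_set in SX.
Qed.

Lemma pt_norm2_ge (X : 'rV[R]_n * R) (r : R) : 0 < r -> ~ pball 0 r X -> r <=
  pt_norm2 X.
Proof.
move=> r0 nb.
have le_sqr (x : R) : ~ (`|x| < r) -> r ^+ 2 <= x ^+ 2.
  move=> /negP; rewrite -leNgt => rx; rewrite -[leRHS]real_normK ?num_real//.
  by rewrite lerXn2r ?nnegrE// ltW.
have dot_ge0 : 0 <= rV_dot X.1 X.1 by apply: sumr_ge0 => i _;
  rewrite -expr2 sqr_ge0.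
suff : r ^+ 2 <= rV_dot X.1 X.1 + X.2 ^+ 2.
  by move=> h; rewrite /pt_norm2 -[leLHS]gtr0_norm// -sqrtr_sqr ler_wsqrtr.
have [h2|/le_sqr h2] := pselect (`|X.2| < r);
  last by rewrite (le_trans h2)// lerDr.
have [i hi] : exists i, ~ (`|X.1 ord0 i| < r).
  apply/existsNP => h1; apply: nb; rewrite pt_ballE rV_ballE//; split.
    by move=> i /=; rewrite mxE sub0r normrN; exact: h1.
  by rewrite -ball_normE/= sub0r normrN.
rewrite (le_trans (le_sqr _ hi))// /rV_dot (bigD1 i)//= -expr2 -addrA lerDl.
by rewrite addr_ge0 ?sqr_ge0// sumr_ge0// => j _; rewrite -expr2 sqr_ge0.
Qed.

Lemma pt_kernel_le (s r : R) (z : pt_leb R n * pt_leb R n) : 0 < s -> 0 < r ->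
  ~ pball z.1 r z.2 -> (pt_kernel s z <= ((r `^ (n.+1%:R + s))^-1)%:E)%E.
Proof.
move=> s0 r0 nb.
have rn : r <= pt_norm2 ((z.1 : 'rV[R]_n * R) - z.2).
  apply: pt_norm2_ge => //; apply: contra_not nb.
  rewrite !pt_ballE !rV_ballE// => -[h1 h2]; split.
    by move=> i; have := h1 i; rewrite !mxE sub0r normrN.
  by move: h2; rewrite -!ball_normE/= sub0r normrN.
have n0 := lt_le_trans r0 rn.
rewrite lee_fin lef_pV2 ?posrE ?powR_gt0//.
by rewrite ge0_ler_powR// ?nnegrE ?addr_ge0// ltW.
Qed.

End shells.

Section finite_interaction.
Context (R : realType) (n : nat) (s : R).
Hypotheses (s0 : 0 < s) (s1 : s < 1).

Let p : R := n.+1%:R + s.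
Let p0 : 0 < p. Proof. by rewrite addr_gt0. Qed.

Let exprn_powR (x a : R) (j : nat) : 0 <= x -> (x ^+ j) `^ a = (x `^ a) ^+ j.
Proof. by move=> x0; rewrite -powR_mulrn// powRAC powR_mulrn// powR_ge0. Qed.

(* The pairs [z] with [2^-J <= |z.1 - z.2| < 2^J] exhaust [U * ~U]; passing from
   [J] to [J + 1] adds a shell close to the diagonal, controlled by the boundary
   layer of [U] of width [2^-J], and a shell far from it, controlled by [|U|].
   Both contributions decay geometrically. *)
Lemma interaction_setC_lt_oo (U : set (pt_leb R n)) (C V : R) :
  leb_measurable U -> (@pt_lebesgue R n U <= V%:E)%E ->
  (forall r : R, 0 < r -> exists S : set (pt_leb R n), [/\ leb_measurable S,
     (forall X Y : 'rV[R]_n * R, U X -> ~ U Y -> ball X r Y -> S X) &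
     (@pt_lebesgue R n S <= (C * r)%:E)%E]) ->
  (\int[@pt_lebesgue2 R n]_(z in U `*` ~` U) pt_kernel s z < +oo)%E.
Proof.
move=> mU UV layer.
have C0 : 0 <= C.
  have [S [_ _ SC]] := layer 1 ltr01.
  by rewrite -[C]mulr1 -lee_fin;
    exact: le_trans (measure_ge0 (@pt_lebesgue R n) S) SC.
have V0 : 0 <= V by rewrite -lee_fin;
  exact: le_trans (measure_ge0 (@pt_lebesgue R n) U) UV.
have mUC : leb_measurable (~` U) by exact: measurableC.
have mUU : measurable (U `*` ~` U) by exact: measurableX.
have mK D : measurable_fun D (@pt_kernel R n s).
  by apply: measurable_funTS; exact: measurable_pt_kernel.
have K0 z : (0 <= @pt_kernel R n s z)%E by exact: pt_kernel_ge0.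
pose tube (r : R) : set (pt_leb R n * pt_leb R n) :=
  [set z | ball (z.1 : 'rV[R]_n * R) r (z.2 : 'rV[R]_n * R)].
have mtube r : measurable (tube r) by exact: measurable_pt_tube.
(* On the shell the kernel is at most r^-p, and the pairs lie over S within sup distance t, a set of
   measure (2t)^(n+1) |S|. *)
have shell (r t : R) (S : set (pt_leb R n)) (c : R) : 0 < r -> 0 < t ->
    leb_measurable S -> (@pt_lebesgue R n S <= c%:E)%E ->
    (forall X Y : 'rV[R]_n * R, U X -> ~ U Y -> ball X t Y -> S X) ->
    (\int[@pt_lebesgue2 R n]_(z in (U `*` ~` U) `&` (tube t `\` tube r))
      pt_kernel s z <=
     ((r `^ p)^-1 * ((t *+ 2) ^+ n.+1 * c))%:E)%E.
  move=> r0 t0 mS Sc US; set Z := _ `&` _.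
  have mZ : measurable Z by apply: measurableI => //; exact: measurableD.
  apply: (@le_trans _ _ (\int[@pt_lebesgue2 R n]_(z in Z) ((r `^ p)^-1)%:E)%E).
    apply: ge0_le_integral => //.
    by move=> z [_ [_ nb]]; exact: pt_kernel_le.
  rewrite integral_cst// EFinM lee_pmul//.
    by rewrite lee_fin invr_ge0 powR_ge0.
  apply: (@le_trans _ _ (pt_lebesgue2 [set z : pt_leb R n * pt_leb R n |
      S z.1 /\ ball (z.1 : 'rV[R]_n * R) t (z.2 : 'rV[R]_n * R)])).
    apply: le_measure; rewrite ?inE//; first exact: measurable_pt_tube_over.
    by move=> z [[Uz nUz] [tz _]]; split=> //; exact: (US z.1 z.2).
  rewrite pt_lebesgue2_tube// EFinM lee_pmul//.
  by rewrite lee_fin exprn_ge0// mulrn_wge0// ltW.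
(* For h = 2^-j, layer, ball and kernel give h h^(n+1) h^-p = h^(1-s); for h = 2^j, ball and kernel
   give h^(n+1) h^-p = h^-s. The power of 1/2 in [al] comes from the inner radius h/2, the 4 in [be]
   from the side 4h of the outer cube. *)
pose q : R := 2^-1 `^ (1 - s).
pose q' : R := (2 `^ s)^-1.
pose al : R := C * 2 ^+ n.+1 * (2^-1 `^ p)^-1.
pose be : R := V * 4 ^+ n.+1.
have near_shell j : exists2 c : R, c <= al * q ^+ j &
    (\int[@pt_lebesgue2 R n]_(z in (U `*` ~` U) `&`
       (tube (2^-1 ^+ j)%R `\` tube (2^-1 ^+ j.+1)%R)) pt_kernel s z <= c%:E)%E.
  have h0 i : 0 < 2^-1 ^+ i :> R by rewrite exprn_gt0// invr_gt0.
  have [S [mS US SC]] := layer _ (h0 j).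
  eexists; last exact: (shell _ _ S _ (h0 j.+1) (h0 j) mS SC US).
  set h := 2^-1 ^+ j.
  have -> : (2^-1 ^+ j.+1) `^ p = (2^-1 `^ p) * h `^ p.
    by rewrite exprS powRM// ?invr_ge0// exprn_ge0// invr_ge0.
  have -> : q ^+ j = h `^ (n.+2%:R - p).
    rewrite /q -exprn_powR ?invr_ge0//; congr (_ `^ _).
    by rewrite /p -[n.+2%:R]natr1 opprD addrACA subrr add0r.
  have hN : h `^ (n.+2%:R - p) = h ^+ n.+2 / h `^ p.
    rewrite powRD; last by apply/implyP => _; rewrite gt_eqF// h0.
    by rewrite powR_mulrn ?ltW ?h0// powRN.
  rewrite hN /al -[h *+ 2]mulr_natr exprMn [h ^+ n.+2]exprSr invfM.
  by rewrite le_eqVlt; apply/predU1P; left; ring.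
have far_shell j : (\int[@pt_lebesgue2 R n]_(z in (U `*` ~` U) `&`
       (tube (2 ^+ j.+1)%R `\` tube (2 ^+ j)%R)) pt_kernel s z <= (be * q' ^+
         j)%:E)%E.
  have h0 i : 0 < 2 ^+ i :> R by rewrite exprn_gt0.
  have /le_trans := shell _ _ U _ (h0 j) (h0 j.+1) mU UV (fun X Y UX _ _ => UX).
  apply; rewrite lee_fin; set h := 2 ^+ j.
  have -> : q' ^+ j = (h `^ s)^-1 by rewrite /q' exprVn -exprn_powR.
  have hN : h `^ p = h ^+ n.+1 * h `^ s.
    rewrite powRD; last by apply/implyP => _; rewrite gt_eqF// h0.
    by rewrite powR_mulrn ?ltW ?h0.
  have hn0 : h ^+ n.+1 != 0 by rewrite expf_neq0// gt_eqF// h0.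
  have hs0 : h `^ s != 0 by rewrite gt_eqF// powR_gt0// h0.
  rewrite hN /be [2 ^+ j.+1]exprS -/h -[(2 * h) *+ 2]mulr_natr.
  have -> : (2 * h * 2) ^+ n.+1 = 4 ^+ n.+1 * h ^+ n.+1.
    by rewrite -exprMn; congr (_ ^+ _); ring.
  by rewrite le_eqVlt; apply/predU1P; left; field; rewrite hn0 hs0.
have one a : (1 : R) `^ a = 1 by rewrite powR1.
have q01 : 0 < q < 1.
  rewrite powR_gt0 ?invr_gt0//= /q -[ltRHS](one (1 - s)).
  by rewrite gt0_ltr_powR ?subr_gt0// ?nnegrE ?invr_ge0// invf_lt1// ltr1n.
have q'01 : 0 < q' < 1.
  rewrite invr_gt0 powR_gt0//= /q' invf_lt1 ?powR_gt0//.
  by rewrite -[ltLHS](one s) gt0_ltr_powR// ?nnegrE// ltr1n.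
pose D J := (U `*` ~` U) `&` (tube (2 ^+ J) `\` tube (2^-1 ^+ J)).
have mD J : measurable (D J) by apply: measurableI => //; exact: measurableD.
have geo (x : R) J : 0 < x < 1 -> (1 - x ^+ J) / (1 - x) <= (1 - x)^-1.
  move=> /andP[x0 x1]; apply: ler_piMl; first by rewrite invr_ge0 subr_ge0 ltW.
  by rewrite gerBl exprn_ge0// ltW.
(* Partial sums of the two geometric series; at J = 0 both radii are 1 and [D 0] is empty. *)
have DJ J : (\int[@pt_lebesgue2 R n]_(z in D J) pt_kernel s z <=
    (al * ((1 - q ^+ J) / (1 - q)) + be * ((1 - q' ^+ J) / (1 - q')))%:E)%E.
  elim: J => [|J IHJ].
    rewrite (_ : D 0%N = set0) ?integral_set0 ?lee_fin ?expr0 ?subrr ?mul0r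
      ?mulr0 ?addr0//.
    by apply/seteqP; split=> // z [_ [+ +]]; rewrite !expr0.
  have [c cal near] := near_shell J.
  have mtt r t : measurable ((U `*` ~` U) `&` (tube t `\` tube r)).
    by apply: measurableI => //; exact: measurableD.
  have sub : D J.+1 `<=` D J `|` (((U `*` ~` U) `&` (tube (2^-1 ^+ J) `\` tube
    (2^-1 ^+ J.+1)))
      `|` ((U `*` ~` U) `&` (tube (2 ^+ J.+1) `\` tube (2 ^+ J)))).
    move=> z [Uz [tz ntz]]; have [t1|t1] := pselect (tube (2^-1 ^+ J) z).
      by right; left; split.
    have [t2|t2] := pselect (tube (2 ^+ J) z); first by left; split.
    by right; right; split.
  apply: le_trans (integral_subset_setU _ _ _ _ _ _ sub) _ => //;
    first exact: measurableU.
  apply: le_trans (leeD IHJ (integral_subset_setU _ _ _ _ _ _ (@subset_refl _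
    _))) _ => //.
    exact: measurableU.
  apply: le_trans (leeD (lexx _) (leeD near (far_shell J))) _.
  rewrite -!EFinD lee_fin.
  have stepE (x : R) : 0 < x < 1 -> (1 - x ^+ J.+1) / (1 - x) = (1 - x ^+ J) /
    (1 - x) + x ^+ J.
    by move=> /andP[_ x1]; rewrite exprS; field; rewrite subr_eq0 gt_eqF.
  by rewrite !stepE// !mulrDr [leRHS]addrACA lerD2l lerD2r.
apply: (@le_lt_trans _ _ (al * (1 - q)^-1 + be * (1 - q')^-1)%:E);
  last exact: ltry.
have al0 : 0 <= al by rewrite !mulr_ge0 ?exprn_ge0// invr_ge0 powR_ge0.
have be0 : 0 <= be by rewrite mulr_ge0 ?exprn_ge0.
apply: (integral_liminf_le (measurable_pt_kernel s) (@pt_kernel_ge0 R n s) (A_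
  := D)) => //.
  move=> [X Y] [/= UX nUY].
  pose r : R := `|(X : 'rV[R]_n * R) - Y|.
  have r0 : 0 < r.
    by rewrite normr_gt0 subr_eq0; apply/eqP => XY; apply: nUY; rewrite -XY.
  have tubeE t : tube t (X, Y) <-> r < t by rewrite /tube/= -ball_normE.
  have half : (`|2^-1 : R| < 1)%R by rewrite ger0_norm// invf_lt1// ltr1n.
  have small e : 0 < e -> \forall J \near \oo, 2^-1 ^+ J < e :> R.
    move=> e0; have /cvgrPdist_lt/(_ _ e0)[N _ NP] := cvg_expr half.
    by exists N => // J NJ; have := NP J NJ; rewrite sub0r normrN ger0_norm.
  near=> J; split=> //; split.
    apply/tubeE; rewrite -[ltLHS]invrK -[ltRHS]invrK -exprVn ltf_pV2 ?posrE
      ?invr_gt0 ?exprn_gt0 ?invr_gt0//.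
    by near: J; apply: small; rewrite invr_gt0.
  rewrite tubeE; apply/negP; rewrite -leNgt ltW//.
  by near: J; exact: small.
apply: nearW => J; apply: le_trans (DJ J) _; rewrite lee_fin.
by apply: lerD; apply: ler_wpM2l => //; exact: geo.
Unshelve. all: by end_near. Qed.

End finite_interaction.

(** * Lipschitz bounds for C^{1,1} functions on bounded sets *)

Section C11_lipschitz.
Context (R : realType) (n : nat).
Implicit Types (x y z nu : 'rV[R]_n).

Lemma rV_coord_le_norm x i : `|x ord0 i| <= `|x|.
Proof.
rewrite [leRHS]mx_normrE.
exact: (le_bigmax _ (fun ij : 'I_1 * 'I_n => `|x ij.1 ij.2|) (ord0, i)).
Qed.

Lemma rV_dot_le x y : `|rV_dot x y| <= `|x| * (n%:R * `|y|).
Proof.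
apply: (le_trans (ler_norm_sum _ _ _)).
apply: (@le_trans _ _ (\sum_(i < n) `|x| * `|y|)).
  by apply: ler_sum => i _; rewrite normrM ler_pM// rV_coord_le_norm.
by rewrite sumr_const card_ord -[leLHS]mulr_natl mulrCA.
Qed.

Lemma rV_dotDl x y z : rV_dot (x + y) z = rV_dot x z + rV_dot y z.
Proof. by rewrite -big_split; apply: eq_bigr => i _; rewrite !mxE mulrDl. Qed.

Lemma rV_dotZl (a : R) x y : rV_dot (a *: x) y = a * rV_dot x y.
Proof. by rewrite mulr_sumr; apply: eq_bigr => i _; rewrite !mxE mulrA. Qed.

Lemma rV_norm2_le x : rV_norm2 x <= n.+1%:R * `|x|.
Proof.
rewrite -[leRHS]ger0_norm ?mulr_ge0// -sqrtr_sqr ler_wsqrtr//.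
have xx : rV_dot x x <= `|x| * (n%:R * `|x|).
  exact: le_trans (ler_norm _) (rV_dot_le _ _).
apply: (le_trans xx); rewrite mulrCA exprMn -expr2 ler_wpM2r ?sqr_ge0//.
by rewrite -natrX ler_nat; nia.
Qed.

Lemma derive_gradient (f : 'rV[R]_n -> R) x v : differentiable f x ->
  'D_v f x = rV_dot v (gradient f x).
Proof.
move=> df; rewrite deriveE// {1}(row_sum_delta v) linear_sum/=.
by apply: eq_bigr => i _; rewrite linearZ/= mxE deriveE.
Qed.

(** A Lipschitz gradient is bounded on bounded sets; the mean value theorem along the segment from y
    to x concludes. *)
Lemma C11_lipschitz_bounded (f : 'rV[R]_n -> R) (B : R) : C11 f ->
  exists2 L : R, 0 < L & forall x y, `|x| <= B -> `|y| <= B ->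
    `|f x - f y| <= L * `|x - y|.
Proof.
move=> [df [k [_ klt]]].
(* The Lipschitz property holds for all constants beyond k, whose sign is unknown: hence [k + 1]
   here and its absolute value in G. *)
have klip := klt (k + 1) (ltr_pwDr ltr01 (lexx k)).
pose g0 := `|gradient f 0|.
pose G := g0 + `|k + 1| * `|B|.
have G0 : 0 <= G by rewrite /G /g0 addr_ge0 ?mulr_ge0.
have gradB z : `|z| <= B -> `|gradient f z| <= G.
  move=> zB; rewrite -[gradient f z](subrK (gradient f 0)).
  apply: (le_trans (ler_normD _ _)); rewrite addrC lerD2l.
  have /= := klip (z, 0) (conj I I); rewrite subr0 => /le_trans; apply.
  apply: (@le_trans _ _ (`|k + 1| * `|z|));
    first by rewrite ler_wpM2r// ler_norm.
  by rewrite ler_wpM2l// (le_trans zB)// ler_norm.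
exists (n%:R * G + 1); first by rewrite ltr_wpDl// mulr_ge0.
move=> x y xB yB.
pose h (t : R) := f (y + t *: (x - y)).
have seg t : t \in `[0, 1] -> `|y + t *: (x - y)| <= B.
  rewrite in_itv/= => /andP[t0 t1].
  rewrite (_ : _ + _ = t *: x + (1 - t) *: y); last first.
    by rewrite scalerBr scalerBl scale1r addrCA.
  apply: (le_trans (ler_normD _ _)); rewrite !normrZ !ger0_norm ?subr_ge0//.
  have : t * `|x| + (1 - t) * `|y| <= t * B + (1 - t) * B.
    by rewrite lerD// ler_wpM2l// subr_ge0.
  by move/le_trans; apply; rewrite -mulrDl addrC subrK mul1r.
have dh (t : R) : is_derive t 1 h ('D_(x - y) f (y + t *: (x - y))).
  have hE : (fun e : R => e^-1 *: ((h \o shift t) (e *: 1) - h t)) =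
      (fun e : R => e^-1 *: ((f \o shift (y + t *: (x - y))) (e *: (x - y)) - f
        (y + t *: (x - y)))).
    apply/funext => e /=; congr (_ *: (f _ - _)).
    by rewrite scalerDl [e *: 1]mulr1 addrCA.
  have dfv : derivable f (y + t *: (x - y)) (x - y) by exact/diff_derivable/df.
  by apply: DeriveDef; rewrite /derivable /derive hE.
have [c c01] : exists2 c, c \in `[0, 1] &
    h 1 - h 0 = 'D_(x - y) f (y + c *: (x - y)) * (1 - 0).
  apply: (@MVT_segment R h (fun t => 'D_(x - y) f (y + t *: (x - y)))) => //.
  by apply: derivable_within_continuous => t _; have [] := dh t.
rewrite /h scale1r scale0r addr0 [y + (x - y)]addrC subrK subr0 mulr1 => ->.
rewrite derive_gradient//; apply: (le_trans (rV_dot_le _ _)).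
rewrite mulrC ler_wpM2r// ler_wpDr// ler_wpM2l//.
exact/gradB/seg.
Qed.

End C11_lipschitz.

Lemma rV_continuous_measurable (R : realType) n (f : 'rV[R]_n -> R) :
  continuous f -> measurable_fun setT (f : 'rV[R]_n -> measurableTypeR R).
Proof.
move=> /continuousP cf; apply: (measurability _ (RGenOpens.measurableE R)).
move=> _ [_ [a [b ->] <-]]; rewrite setTI; apply: open_rV_measurable.
exact/cf/interval_open.
Qed.

(** * The boundary layer of a C^{1,1} domain *)

Section boundary_layer.
Context (R : realType) (n : nat).
Implicit Types (x y nu : 'rV[R]_n) (A S Omega : set 'rV[R]_n).

(* Translating the slab by multiples of [3 w nu] gives about [1 / (3 w)]
  disjoint
   sets of the same measure in a fixed ball. *)
Lemma rV_lebesgue_slab (G : 'rV[R]_n -> R) x0 nu (rho w : R) S :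
  0 < rho -> 0 < w -> 6 * w <= 1 -> measurable S -> S `<=` ball x0 rho ->
  (forall x, S x -> `|G x| <= w) ->
  (forall x t, G (x + t *: nu) = G x + t) ->
  (rV_lebesgue R n S <= (6 * ((rho + `|nu|) *+ 2) ^+ n * w)%:E)%E.
Proof.
move=> rho0 w0 w1 mS SB SG Gnu.
pose J := Num.truncn (3 * w)^-1.
have w30 : 0 < 3 * w by rewrite mulr_gt0.
have w3i : 0 < (3 * w)^-1 by rewrite invr_gt0.
have /andP[J1 J2] := truncn_itv (ltW w3i); rewrite -/J in J1 J2.
(* As 1/(3w) >= 2, truncation loses at most half of it. This is the origin of the factor 6. *)
have Jw : (6 * w)^-1 <= J%:R.
  have w6 : 1 <= (6 * w)^-1 by rewrite invf_ge1// mulr_gt0.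
  have e63 : (3 * w)^-1 = (6 * w)^-1 + (6 * w)^-1 by field; rewrite gt_eqF.
  move: J2; rewrite -[J.+1%:R]natr1 e63 => J2; lra.
pose F (j : nat) := [set x : 'rV[R]_n | S (x + - (3 * w * j%:R) *: nu)].
have mF j : measurable (F j) by exact: measurable_preimage_rV_shift.
have FE j : rV_lebesgue R n (F j) = rV_lebesgue R n S by exact:
  rV_lebesgue_shift.
have GF j x : F j x -> `|G x - 3 * w * j%:R| <= w.
  by move=> /SG; rewrite Gnu.
have tF : trivIset `I_J F.
  have lt_disj i j : (i < j)%N -> forall x, F i x -> F j x -> False.
    move=> ij x /GF + /GF; rewrite !ler_norml => /andP[_ h1] /andP[h2 _].
    have : i%:R + 1 <= j%:R :> R by rewrite natr1 ler_nat.
    rewrite -(ler_pM2l w30) mulrDr mulr1; lra.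
  move=> i j _ _ [x [Fix Fjx]]; have [ij|ji|//] := ltngtP i j.
    by case: (lt_disj _ _ ij _ Fix Fjx).
  by case: (lt_disj _ _ ji _ Fjx Fix).
(* All shifts are multiples of nu by at most 3 w J <= 1. *)
have FB : \big[setU/set0]_(j < J) F j `<=` ball x0 (rho + `|nu|).
  rewrite -bigcup_mkord => x [j /= jJ /SB]; rewrite -!ball_normE/= => xj.
  rewrite -(subrK (- (3 * w * j%:R) *: nu) (x0 - x)) (le_lt_trans (ler_normD _
    _))//.
  apply: ltr_leD; first by rewrite -addrA -opprD.
  rewrite normrZ normrN ger0_norm ?mulr_ge0 ?(ltW w0)//.
  rewrite ler_piMl//; apply: (@le_trans _ _ (3 * w * J%:R)).
    by rewrite ler_wpM2l ?(ltW w30)// ler_nat ltnW.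
  by rewrite -ler_pdivlMl// mulr1.
have rn0 : 0 < rho + `|nu| by rewrite ltr_pwDl.
have JS : (rV_lebesgue R n S *+ J <= (((rho + `|nu|) *+ 2) ^+ n)%:E)%E.
  rewrite -(rV_lebesgue_ball x0 rn0).
  apply: (@le_trans _ _ (rV_lebesgue R n (\big[setU/set0]_(j < J) F j))).
    rewrite measure_semi_additive_ord_I//; last exact: bigsetU_measurable.
    by rewrite (eq_bigr (fun=> rV_lebesgue R n S)) ?sumr_const ?card_ord// => i
      _; exact: FE.
  by apply: le_measure => //; rewrite inE;
    [exact: bigsetU_measurable|exact: measurable_rV_ball].
have Sfin : rV_lebesgue R n S \is a fin_num.
  rewrite ge0_fin_numE//; apply: (@le_lt_trans _ _ (rV_lebesgue R n (ball x0
    rho))).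
    by apply: le_measure => //; rewrite inE//; exact: measurable_rV_ball.
  by rewrite rV_lebesgue_ball// ltry.
have S0 : 0 <= fine (rV_lebesgue R n S) by rewrite fine_ge0.
move: JS; rewrite -(fineK Sfin) -EFin_natmul !lee_fin -[_ *+ J]mulr_natr => JS.
have J0 : 0 < J%:R :> R by apply: lt_le_trans Jw; rewrite invr_gt0 mulr_gt0.
rewrite -mulrAC -ler_pdivrMl ?mulr_gt0//.
by apply: le_trans JS; rewrite [leLHS]mulrC ler_wpM2l.
Qed.

(** Localized to A so that finitely many local layers can be glued, and limited to small widths
    since a chart says nothing at large scales. *)
Definition thin_layer Omega A := exists C d0 : R, 0 < d0 /\
  forall d : R, 0 < d < d0 -> exists S, [/\ measurable S,
    (forall x y, A x -> Omega x -> ~ Omega y -> ball x d y -> S x) &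
    (rV_lebesgue R n S <= (C * d)%:E)%E].

Lemma thin_layer0 Omega : thin_layer Omega set0.
Proof.
exists 0, 1; split=> // d _; exists set0; split=> //.
by rewrite measure0 mul0r.
Qed.

Lemma thin_layerU Omega A B : thin_layer Omega A -> thin_layer Omega B ->
  thin_layer Omega (A `|` B).
Proof.
move=> [C1 [d1 [d10 h1]]] [C2 [d2 [d20 h2]]].
exists (C1 + C2), (Num.min d1 d2); split; first by rewrite lt_min d10 d20.
move=> d /andP[d0]; rewrite lt_min => /andP[dd1 dd2].
have [|S1 [mS1 S1P S1C]] := h1 d; first by rewrite d0.
have [|S2 [mS2 S2P S2C]] := h2 d; first by rewrite d0.
exists (S1 `|` S2); split; first exact: measurableU.
  by move=> x y [Ax|Bx] Ox nOy xy; [left; exact: S1P xy|right; exact: S2P xy].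
rewrite mulrDl EFinD; apply: le_trans (leeD S1C S2C).
exact: measureU2.
Qed.

(** Away from the boundary the layer is empty: two points at distance below r/2, one of them in the
    half ball, both stay in the large ball, so Omega cannot separate them. *)
Lemma thin_layer_disjoint Omega x0 (r : R) : 0 < r ->
  (ball x0 r `<=` Omega \/ ball x0 r `&` Omega = set0) ->
  thin_layer Omega (ball x0 (r / 2)).
Proof.
move=> r0 h; exists 0, (r / 2); split; first by rewrite divr_gt0.
move=> d /andP[d0 dr]; exists set0; split=> //; last by rewrite measure0 mul0r.
move=> x y x0x Ox nOy xy; case: h => h; last first.
  have : (ball x0 r `&` Omega) x.
    by split=> //; apply: le_ball x0x;
      rewrite ler_pdivrMr// ler_peMr ?ltW// ltr1n.
  by rewrite h.
apply: nOy; apply: h; rewrite (splitr r); apply: ball_triangle x0x _.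
by apply: le_ball xy; exact: ltW.
Qed.

(** G is the signed height above the graph in direction nu, negative exactly on Omega near x0. It is
    Lipschitz there, so a point of Omega within d of the complement satisfies |G| <= L d, and the
    slab estimate applies. *)
Lemma thin_layer_chart Omega x0 (r : R) nu (gam : 'rV[R]_n -> R) :
  0 < r -> rV_norm2 nu = 1 -> C11 gam ->
  (forall x, rV_norm2 (x - x0) < r ->
     Omega x <-> rV_dot x nu < gam (x - rV_dot x nu *: nu)) ->
  exists2 rho : R, 0 < rho & thin_layer Omega (ball x0 rho).
Proof.
move=> r0 nu1 gamC chart.
have nunu : rV_dot nu nu = 1.
  have nn0 : 0 <= rV_dot nu nu by apply: sumr_ge0 => i _;
    rewrite -expr2 sqr_ge0.
  by rewrite -(sqr_sqrtr nn0) -/(rV_norm2 nu) nu1 expr1n.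
pose P x := x - rV_dot x nu *: nu.
pose G x := rV_dot x nu - gam (P x).
(* Since nu is a unit vector, P is invariant along nu. *)
have Gnu x t : G (x + t *: nu) = G x + t.
  rewrite /G /P rV_dotDl rV_dotZl nunu mulr1 scalerDl opprD addrACA subrr addr0.
  by rewrite addrAC.
(* The sup ball of radius 2 rho must fit in the Euclidean ball of radius r, where the chart holds;
   the norms compare with factor n + 1. *)
pose rho := r / (2 * n.+1%:R + 1).
have rho0 : 0 < rho by rewrite divr_gt0// ltr_wpDl.
have chartG x : ball x0 (2 * rho) x -> Omega x <-> G x < 0.
  move=> x0x; rewrite /G subr_lt0; apply: chart.
  apply: le_lt_trans (rV_norm2_le _) _.
  move: x0x; rewrite -ball_normE/= distrC => x0x.
  have : n.+1%:R * `|x - x0| <= n.+1%:R * (2 * rho) by rewrite ler_wpM2l// ltW.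
  move/le_lt_trans; apply.
  by rewrite /rho !mulrA ltr_pdivrMr ?ltr_wpDl//; lra.
pose c := n%:R * `|nu|.
have c0 : 0 <= c by rewrite mulr_ge0.
have PB x : `|P x| <= (1 + c * `|nu|) * `|x|.
  apply: (le_trans (ler_normB _ _)); rewrite mulrDl mul1r lerD2l normrZ.
  by rewrite mulrAC ler_wpM2r// mulrC rV_dot_le.
have P_sub x y : P x - P y = P (x - y).
  by rewrite /P -[- y]scaleN1r rV_dotDl rV_dotZl scalerDl !scaleN1r mulN1r
    scaleNr; rewrite !opprD !opprK addrACA.
pose m := `|x0| + 2 * rho.
have [Lg Lg0 gamL] := C11_lipschitz_bounded ((1 + c * `|nu|) * m) gamC.
pose L := c + Lg * (1 + c * `|nu|) + 1.
have cnu0 : 0 <= 1 + c * `|nu| by rewrite addr_ge0 ?mulr_ge0.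
have L0 : 0 < L.
  by rewrite /L ltr_wpDl// addr_ge0// mulr_ge0// ltW.
have GL x y : ball x0 (2 * rho) x -> ball x0 (2 * rho) y ->
    `|G x - G y| <= L * `|x - y|.
  move=> x0x x0y.
  have bm z : ball x0 (2 * rho) z -> `|P z| <= (1 + c * `|nu|) * m.
    rewrite -ball_normE/= distrC => x0z; apply: (le_trans (PB _)).
    apply: ler_wpM2l; first exact: cnu0.
    rewrite -[z](subrK x0) (le_trans (ler_normD _ _))// addrC lerD2l.
    exact: ltW.
  have -> : G x - G y = rV_dot (x - y) nu - (gam (P x) - gam (P y)).
    by rewrite /G -[- y]scaleN1r rV_dotDl rV_dotZl mulN1r; ring.
  apply: (le_trans (ler_normB _ _)).
  have h1 : `|rV_dot (x - y) nu| <= c * `|x - y| by rewrite mulrC rV_dot_le.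
  have h2 : `|gam (P x) - gam (P y)| <= Lg * (1 + c * `|nu|) * `|x - y|.
    apply: (le_trans (gamL _ _ (bm _ x0x) (bm _ x0y))); rewrite -mulrA.
    by rewrite ler_wpM2l ?(ltW Lg0)// P_sub.
  apply: (le_trans (lerD h1 h2)); rewrite -mulrDl /L.
  by rewrite ler_wpM2r// lerDl.
exists rho => //.
(* Widths below rho keep both points in the ball of radius 2 rho; widths below 1/(6L) give the slab
   condition 6 w <= 1 for w = L d. *)
exists (6 * ((rho + `|nu|) *+ 2) ^+ n * L), (Num.min rho (6 * L)^-1).
split; first by rewrite lt_min rho0 invr_gt0 mulr_gt0.
move=> d /andP[d0]; rewrite lt_min => /andP[drho dL].
have mdot : measurable_fun setT (fun x : 'rV[R]_n => rV_dot x nu :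
  measurableTypeR R).
  apply: measurable_sum => i; apply: measurable_funM => //.
  exact: measurable_rV_coord.
have mP : measurable_fun setT P.
  apply: measurable_fun_rV => i.
  rewrite (_ : (fun _ => _) = (fun x : 'rV[R]_n =>
      (x ord0 i : measurableTypeR R) - rV_dot x nu * nu ord0 i)); last first.
    by apply/funext => x; rewrite /P !mxE.
  by apply: measurable_funB; [exact: measurable_rV_coord|exact:
    measurable_funM].
have mG : measurable_fun setT (G : 'rV[R]_n -> measurableTypeR R).
  apply: measurable_funB => //; apply: measurableT_comp mP.
  apply: rV_continuous_measurable => x.
  by have [dgam _] := gamC; exact: differentiable_continuous.
have mSd : measurable (ball x0 rho `&` [set x | `|G x| <= L * d]).
  apply: measurableI; first exact: measurable_rV_ball.
  have := mG measurableT _ (measurable_itv `[- (L * d), L * d]); rewrite setTI.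
  by congr measurable; apply/seteqP; split=> x /=; rewrite in_itv/= ler_norml.
exists (ball x0 rho `&` [set x | `|G x| <= L * d]); split=> //.
- move=> x y x0x Ox nOy xy; split=> //=.
  have x2 : ball x0 (2 * rho) x.
    by apply: le_ball x0x; rewrite ler_peMl ?ltW// ltr1n.
  have y2 : ball x0 (2 * rho) y.
    rewrite mulrDl mul1r; apply: ball_triangle x0x _.
    by apply: le_ball xy; exact: ltW.
  have Gx : G x < 0 by apply/(chartG _ x2).
  have Gy : 0 <= G y by rewrite leNgt; apply/negP => /(chartG _ y2).
  have := GL _ _ x2 y2; move: xy; rewrite -ball_normE/= => xy.
  have : L * `|x - y| <= L * d by rewrite ler_wpM2l ?ltW.
  by rewrite !ler_norml => ? /andP[? ?]; apply/andP; split; lra.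
- rewrite -[_ * L * d]mulrA.
  apply: (@rV_lebesgue_slab G x0 nu rho (L * d)) => //.
  + by rewrite mulr_gt0.
  + by rewrite mulrA -ler_pdivlMl ?mulr_gt0// mulr1 ltW.
  + by move=> x [].
Qed.

(** Every point has a ball with a thin layer: by a chart on the boundary, trivially elsewhere.
    Finitely many of these balls cover the compact closure. *)
Lemma boundary_layer Omega : open Omega -> bounded_set Omega -> C11_boundary
  Omega ->
  thin_layer Omega setT.
Proof.
move=> oO bO C11O.
have [B [Br /(_ (B + 1))]] := bO.
rewrite ltrDl ltr01 => /(_ isT) OB.
have loc x0 : exists r : R, 0 < r /\ thin_layer Omega (ball x0 r).
  have [Ocl|Ocl] := pselect (closure Omega x0); last first.
    have /nbhs_ballP[e /= e0 eO] : nbhs x0 (~` closure Omega).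
      by apply: open_nbhs_nbhs; split=> //; exact/closed_openC/closed_closure.
    exists (e / 2); split; first by rewrite divr_gt0.
    apply: thin_layer_disjoint => //; right; apply/seteqP;
      split=> // x [x0x Ox].
    by have := eO x x0x; apply; exact: subset_closure.
  have [Oint|Oint] := pselect (interior Omega x0).
    have /nbhs_ballP[e /= e0 eO] := Oint.
    exists (e / 2); split; first by rewrite divr_gt0.
    by apply: thin_layer_disjoint => //; left.
  have [r [nu [gam [r0 nu1 gamC chart]]]] := C11O x0 (conj Ocl Oint).
  by have [rho rho0 h] := thin_layer_chart r0 nu1 gamC chart; exists rho.
have /choice[rr rrP] := loc.
have : compact (closure Omega).
  apply: bounded_closed_compact; last exact: closed_closure.
  exists (B + 1); split; first exact: num_real.
  move=> M BM x; rewrite closureE => clx /=.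
  have : closed_ball_ (fun z : 'rV[R]_n => `|z|) 0 M x;
    last by rewrite /closed_ball_/= sub0r normrN.
  apply: clx; split; first exact: closed_closed_ball_.
  by move=> y Oy; rewrite /closed_ball_/= sub0r normrN (le_trans (OB y Oy))//
    ltW.
rewrite compact_cover => /(_ _ setT (fun x => ball x (rr x))) [].
- by move=> x _; exact: ball_open.
- by move=> x _; exists x => //; apply: ballxx; have [] := rrP x.
move=> D _ OD.
have : thin_layer Omega (\big[setU/set0]_(x <- finmap.enum_fset D) ball x (rr
  x)).
  elim/big_ind: _ => [|A A'|x _].
  - exact: thin_layer0.
  - exact: thin_layerU.
  - by have [] := rrP x.
rewrite -bigcup_fset => -[C [d0 [d00 h]]]; exists C, d0; split=> // d dd.
have [S [mS SP SC]] := h d dd; exists S; split=> // x y _ Ox.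
by apply: SP => //; apply: OD; exact: subset_closure.
Qed.

End boundary_layer.

(** * Boundary layers of the bounded cylinders *)

Section cylinders.
Context (R : realType) (n : nat) (Omega : set 'rV[R]_n).
Hypotheses (Omega_open : open Omega) (Omega_bounded : bounded_set Omega).

Lemma cylinder_measurable (k : R) :
  measurable (cylinder Omega k : set ('rV[R]_n * measurableTypeR R)).
Proof. by apply: measurableX; [exact: open_rV_measurable|exact: measurable_itv].
  Qed.

Lemma cylinder_layer (C11O : C11_boundary Omega) (k : R) : 0 < k ->
  exists C V : R, (@pt_lebesgue R n (cylinder Omega k) <= V%:E)%E /\
  forall r : R, 0 < r -> exists S : set (pt_leb R n), [/\ leb_measurable S,
     (forall X Y : 'rV[R]_n * R, cylinder Omega k X -> ~ cylinder Omega k Y ->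
        ball X r Y -> S X) &
     (@pt_lebesgue R n S <= (C * r)%:E)%E].
Proof.
move=> k0.
have mO : measurable Omega by exact: open_rV_measurable.
have [W OW] : exists W : R, (rV_lebesgue R n Omega <= W%:E)%E.
  have [B [_ OB]] := Omega_bounded.
  exists (((`|B| + 2) *+ 2) ^+ n).
  rewrite -(@rV_lebesgue_ball R n 0); last by rewrite ltr_wpDl.
  apply: le_measure; rewrite ?inE//; first exact: measurable_rV_ball.
  move=> x Ox; rewrite -ball_normE/= sub0r normrN.
  have BB : B < `|B| + 1 by rewrite ltr_pwDr// ler_norm.
  by apply: le_lt_trans (OB _ BB x Ox) _; rewrite ltrD2l ltr1n.
have W0 : 0 <= W by rewrite -lee_fin (le_trans _ OW).
have rect (A : set 'rV[R]_n) (a : R) (I : set (measurableTypeR R)) (b : R) :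
    measurable A -> measurable I -> (rV_lebesgue R n A <= a%:E)%E ->
    (@lebesgue_measure R I <= b%:E)%E -> (@pt_lebesgue R n (A `*` I) <= (a *
      b)%:E)%E.
  move=> mA mI Aa Ib; rewrite pt_lebesgue_borel; last exact: measurableX.
  by rewrite pt_borel_lebesgueX// EFinM lee_pmul.
have itv (a b : R) : a <= b -> (@lebesgue_measure R `]a, b[%classic <= (b -
  a)%:E)%E.
  by move=> ab; rewrite lebesgue_measure_itv/= lte_fin; case: ifP => // _;
    rewrite lee_fin subr_ge0.
have UV : (@pt_lebesgue R n (cylinder Omega k) <= (W * (k *+ 2))%:E)%E.
  apply: rect => //.
  by apply: (le_trans (itv _ _ _)); [lra|rewrite opprK mulr2n].
have [C [d0 [d00 layer]]] := boundary_layer Omega_open Omega_bounded C11O.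
have mU := cylinder_measurable k.
(* The terms of the constant pay for the lateral layer, for the two ends of height r, and for r >=
   d0, where the whole cylinder serves as layer. *)
exists (`|C| * (k *+ 2) + W * 2 + W * (k *+ 2) / d0), (W * (k *+ 2));
  split=> //.
move=> r r0; have [rd|rd] := ltP r d0; last first.
  exists (cylinder Omega k); split=> //; first exact: pt_borel_leb_measurable.
  apply: (le_trans UV); rewrite lee_fin mulrDl ler_wpDl//.
    by rewrite !(mulr_ge0, addr_ge0, mulrn_wge0)// ltW.
  by rewrite -mulrA ler_peMr ?mulr_ge0 ?mulrn_wge0 ?(ltW k0)// ler_pdivlMl//
    mulr1.
have [|S [mS SP SC]] := layer r; first by rewrite r0.
pose ends : set (measurableTypeR R) := `]-k, -k + r[%classic `|` `]k - r,
  k[%classic.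
have mends : measurable ends by apply: measurableU; exact: measurable_itv.
have endsr : (@lebesgue_measure R ends <= (r *+ 2)%:E)%E.
  apply: (le_trans (measureU2 _ _ _)) => //.
  have h1 : -k <= -k + r by lra.
  have h2 : k - r <= k by lra.
  apply: (le_trans (leeD (itv _ _ h1) (itv _ _ h2))).
  by rewrite -EFinD lee_fin; lra.
pose Ik : set (measurableTypeR R) := `]-k, k[%classic.
pose T : set ('rV[R]_n * measurableTypeR R) := (S `*` Ik) `|` (Omega `*` ends).
have mT1 : measurable (S `*` Ik : set ('rV[R]_n * measurableTypeR R)).
  by apply: measurableX => //; exact: measurable_itv.
have mT2 : measurable (Omega `*` ends) by exact: measurableX.
exists T; split.
- by apply: pt_borel_leb_measurable; exact: measurableU.
- move=> [x t] [y u] [/= Ox]; rewrite in_itv/= => /andP[kt tk] nU [/= xy tu].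
  have [Oy|Oy] := pselect (Omega y); last first.
    by left; split=> /=; [exact: SP xy|rewrite /Ik/= in_itv/= kt].
  right; split=> //=.
  move: tu; rewrite -ball_normE/= ltr_norml => /andP[h1 h2].
  have [uk|uk] := ltP (- k) u; last by left; rewrite /= in_itv/= kt/=; lra.
  have [uk'|uk'] := ltP u k; last by right; rewrite /= in_itv/= tk andbT; lra.
  by exfalso; apply: nU; split=> //=; rewrite in_itv/= uk.
- have mu2 : (@pt_lebesgue R n T <= @pt_lebesgue R n (S `*` Ik) +
      @pt_lebesgue R n (Omega `*` ends))%E.
    by apply: measureU2; exact: pt_borel_leb_measurable.
  apply: (le_trans mu2).
  have kk : -k <= k by lra.
  apply: (le_trans (leeD (rect _ _ _ _ mS (measurable_itv _) SC (itv _ _ kk))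
    (rect _ _ _ _ mO mends OW endsr))).
  rewrite -EFinD lee_fin opprK -mulr2n !mulrDl.
  have h1 : C * r * (k *+ 2) <= `|C| * (k *+ 2) * r.
    rewrite mulrAC ler_wpM2r ?(ltW r0)// ler_wpM2r ?mulrn_wge0 ?(ltW k0)//.
    exact: ler_norm.
  have h2 : 0 <= W * (k *+ 2) / d0 * r.
    rewrite (mulr_ge0 _ (ltW r0))// divr_ge0 ?(ltW d00)// mulr_ge0//
      mulrn_wge0//.
    exact: ltW.
  have h3 : W * (r *+ 2) = W * 2 * r by rewrite -mulrA mulr_natl.
  by rewrite h3 -[leLHS]addr0; apply: lerD => //; rewrite lerD2r.
Qed.

End cylinders.

(** * Minimizers in the cylinders *)

Section minimality.
Context (R : realType) (n : nat) (s : R).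
Implicit Types E F G U V : set (pt_leb R n).
Local Notation perim := (nl_perimeter (@pt_lebesgue2 R n) (@pt_kernel R n s)).
Local Notation minim := (nl_minimal (@pt_lebesgue2 R n) (@pt_kernel R n s)).

(** A competitor G whose data agree only almost everywhere is replaced by [G'], with exactly the
    data of E. It differs from G by a null set, so the perimeter is unchanged. *)
Lemma s_minimal_nl E U : leb_measurable E -> leb_measurable U ->
  s_minimal s E U <-> (perim U E < +oo)%E /\ minim U E.
Proof.
move=> mE mU; rewrite /s_minimal s_perimeterE//; split=> -[fin minE];
  split=> //.
  move=> G mG GE; rewrite -[leRHS]s_perimeterE//; apply: minE => //.
  rewrite GE; apply: negligibleS (negligible_set0 _) => x.
  by case=> -[].
move=> G mG GE; rewrite [leRHS]s_perimeterE//.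
pose G' := (G `&` U) `|` (E `\` U).
have mG' : leb_measurable G' by apply: measurableU;
  [exact: measurableI|exact: measurableD].
rewrite (@nl_perimeter_ae R n s U G G')//.
  apply: minE => //; apply/seteqP; split=> x.
    by case=> -[[]|].
  by move=> [Ex nU]; split=> //; right.
apply: negligibleS GE => x [[Gx nG']|[G'x nG]].
  have nU : ~ U x by move=> Ux; apply: nG'; left.
  by left; split=> // -[Ex _]; apply: nG'; right.
case: G'x => [[]//|Ex]; right; split=> // -[]//.
Qed.

Lemma s_minimal_ae E F U : leb_measurable E -> leb_measurable F ->
  leb_measurable U -> ae_eq_set E F -> s_minimal s E U -> s_minimal s F U.
Proof.
move=> mE mF mU EF [fin minE].
have PE : s_perimeter s E U = s_perimeter s F U.
  by rewrite !s_perimeterE//; exact: nl_perimeter_ae.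
rewrite /s_minimal -PE; split; first exact: fin.
move=> G mG GF; apply: minE; first exact: mG.
apply: ae_eq_set_trans GF _; apply: negligibleS EF => x.
move=> [[[Fx nU] nE]|[[Ex nU] nF]].
  by right; split; [exact: Fx|move=> Ex; exact: nE (conj Ex nU)].
by left; split; [exact: Ex|move=> Fx; exact: nF (conj Fx nU)].
Qed.

Lemma s_minimal_sub E U V : U `<=` V -> leb_measurable E -> leb_measurable U ->
  leb_measurable V -> s_minimal s E V -> s_minimal s E U.
Proof.
move=> UV mE mU mV /(s_minimal_nl mE mV)[fin minE].
apply/(s_minimal_nl mE mU); split; last first.
  exact: (nl_minimal_sub (measurable_pt_kernel s) (@pt_kernel_ge0 R n s) UV).
apply: le_lt_trans fin; apply: nl_perimeter_le_integral => //.
- exact: measurable_pt_kernel.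
- exact: pt_kernel_ge0.
- exact: measurable_cut_pairs.
- by move=> z [Ez nEz [/UV|/UV] Uz]; split=> //; [left|right].
Qed.

End minimality.

(** * Exhaustion of the infinite cylinder *)

Section exhaustion.
Context (R : realType) (n : nat) (s : R) (Omega : set 'rV[R]_n).
Hypotheses (s0 : 0 < s) (s1 : s < 1) (Omega_open : open Omega).
Hypotheses (Omega_bounded : bounded_set Omega) (Omega_C11 : C11_boundary Omega).
Implicit Types E F : set (pt_leb R n).

Let cyl (j : nat) : set (pt_leb R n) := cylinder Omega j.+1%:R.

Let cyl_measurable j : leb_measurable (cyl j).
Proof. by apply: pt_borel_leb_measurable; exact: cylinder_measurable. Qed.

Let cyl_nd : nondecreasing_seq cyl.
Proof.
move=> i j ij; apply/subsetPset => -[x t] [/= Ox];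
  rewrite in_itv/= => /andP[h1 h2].
split=> //=; rewrite in_itv/=.
have : i.+1%:R <= j.+1%:R :> R by rewrite ler_nat.
by move: h1 h2; lra.
Qed.

Let bigcup_cyl : \bigcup_j cyl j = infinite_cylinder Omega.
Proof.
apply/seteqP; split=> [[x t] [j _ [/= Ox _]]|[x t] [/= Ox _]]; first by split.
exists (Num.truncn `|t|) => //; split=> //=.
by rewrite in_itv/= -ltr_norml truncnS_gt.
Qed.

(** A relatively compact window has bounded height, so it lies in one of the cylinders, and
    minimality passes to smaller windows. *)
Lemma locally_s_minimal_cylinders E : leb_measurable E ->
  (forall j, s_minimal s E (cyl j)) -> locally_s_minimal s E (infinite_cylinder
    Omega).
Proof.
move=> mE minE U' oU' [cU' U'O].
have [M [_ MU']] := compact_bounded cU'.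
have MM : M < `|M| + 1 by rewrite ltr_pwDr// ler_norm.
apply: (s_minimal_sub (V := cyl (Num.truncn (`|M| + 1)))) => //.
- move=> [x t] U'x; have clx := subset_closure U'x; split=> /=.
    by have [] := U'O _ clx.
  have := MU' _ MM _ clx; rewrite /= prod_normE ge_max => /andP[_ tM].
  by rewrite in_itv/= -ltr_norml (le_lt_trans tM)// truncnS_gt.
- by apply: pt_borel_leb_measurable; exact: open_pt_measurable.
Qed.

(** The data given to the exhaustion are F with its part in the infinite cylinder deleted, hence
    disjoint from all windows. *)
Lemma s_minimal_cylinders_exists F : leb_measurable F -> exists E,
  [/\ leb_measurable E,
      E `\` infinite_cylinder Omega = F `\` infinite_cylinder Omega &
      forall j, s_minimal s E (cyl j)].
Proof.
move=> mF.
have mIC : leb_measurable (infinite_cylinder Omega).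
  rewrite -bigcup_cyl; apply: bigcup_measurable => j _; exact: cyl_measurable.
have mD : leb_measurable (F `\` infinite_cylinder Omega) by exact: measurableD.
have fin j : (\int[@pt_lebesgue2 R n]_(z in cyl j `*` ~` cyl j) pt_kernel s z <
  +oo)%E.
  have [C [V [UV layer]]] := cylinder_layer Omega_open Omega_bounded Omega_C11
    (ltr0Sn R j).
  exact: (interaction_setC_lt_oo s0 s1 (cyl_measurable j) UV layer).
have [||E [mE ED finE minE]] := @nl_minimal_exhaustion _ _ _ (@pt_lebesgue2 R n)
  (@pt_kernel R n s) (measurable_pt_kernel s) (@pt_kernel_ge0 R n s) cyl
  (F `\` infinite_cylinder Omega) cyl_measurable cyl_nd mD _ fin _.
- by rewrite bigcup_cyl; apply/seteqP; split=> // x [[]].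
- move=> j; have mc := cyl_measurable j.
  have mC : leb_measurable (~` cyl j) by exact: measurableC.
  by rewrite -interactionE// interactionC// interactionE.
exists E; split; [exact: mE|by rewrite -ED bigcup_cyl|move=> j].
exact: (s_minimal_nl s mE (cyl_measurable j)).2 (conj (finE j) (minE j)).
Qed.

End exhaustion.

(** * Transfer of minimality from E to F *)

Unset Implicit Arguments.
Set Strict Implicit.
Set Printing Implicit Defensive.

Theorem proposition4p3 (R : realType) (n : nat) (s : R)
    (Omega : set 'rV[R]_n) (v : 'rV[R]_n -> R) (M : R) (k0 : int)
    (F : set ('rV[R]_n * R))
    (hn : (0 < n)%N) (hs0 : 0 < s) (hs1 : s < 1)
    (Omega_open : open Omega) (Omega_bounded : bounded_set Omega)
    (Omega_C11 : C11_boundary Omega)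
    (v_measurable : measurable_fun setT (v : rV_leb R n -> R))
    (v_bounded : locally_bounded v)
    (M_gt0 : 0 < M) (M_bound : height_bound s Omega v M)
    (k0_gt : M < k0%:~R)
    (k0_smallest : forall j : int, M < j%:~R -> k0 <= j)
    (F_measurable : leb_measurable F)
    (F_minimal : s_minimal s F (cylinder Omega k0%:~R))
    (F_exterior : ae_eq_set (F `\` cylinder Omega k0%:~R)
                            (subgraph v `\` cylinder Omega k0%:~R)) :
  (forall k : int, k0 <= k -> s_minimal s F (cylinder Omega k%:~R)) /\
  locally_s_minimal s F (infinite_cylinder Omega).
Proof.
pose cyl (j : nat) := cylinder Omega (j.+1%:R : R).
have mcyl j : leb_measurable (cyl j).
  by apply: pt_borel_leb_measurable; exact: cylinder_measurable.
have k00 : 0 < k0 by rewrite -(ltr0z R) (lt_trans M_gt0).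
have pos_int (k : int) : 0 < k -> exists j : nat, k = j.+1.
  by case: k => [[|j]|j]// _; exists j.
have [j0 k0E] := pos_int _ k00.
have cylS i j : (i <= j)%N -> cyl i `<=` cyl j.
  move=> ij [x t] [/= Ox]; rewrite in_itv/= => /andP[h1 h2].
  split=> //=; rewrite in_itv/=.
  have : i.+1%:R <= j.+1%:R :> R by rewrite ler_nat.
  by move: h1 h2; lra.
have [E [mE EF minE]] :=
  s_minimal_cylinders_exists hs0 hs1 Omega_open Omega_bounded Omega_C11
    F_measurable.
have cyl_inf j : cyl j `<=` infinite_cylinder Omega by move=> [x t] [].
have locE : locally_s_minimal s E (infinite_cylinder Omega).
  exact: locally_s_minimal_cylinders.
have ae_eq_setDS (A B C D : set ('rV[R]_n * R)) : C `<=` D ->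
    ae_eq_set (A `\` C) (B `\` C) -> ae_eq_set (A `\` D) (B `\` D).
  move=> CD; apply: negligibleS => x [[[Ax nD] nB]|[[Bx nD] nA]].
    by left; split; [split=> // /CD|move=> [Bx _]; apply: nB].
  by right; split; [split=> // /CD|move=> [Ax _]; apply: nA].
rewrite k0E in k0_gt F_minimal F_exterior.
change (s_minimal s F (cyl j0)) in F_minimal.
change (ae_eq_set (F `\` cyl j0) (subgraph v `\` cyl j0)) in F_exterior.
have extE : ae_eq_set (E `\` infinite_cylinder Omega)
    (subgraph v `\` infinite_cylinder Omega).
  rewrite EF; exact: ae_eq_setDS F_exterior.
(* E now agrees with the subgraph off Omega x [-M, M]. Because M < k0 this box lies in [cyl j0], off
   which F is the subgraph too. *)
have [_ _ EM] := M_bound E mE locE extE.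
have MC : Omega `*` `[- M, M] `<=` cyl j0.
  move=> [x t] [/= Ox]; rewrite in_itv/= => /andP[h1 h2]; split=> //=.
  have k0M : M < j0.+1%:R by [].
  by rewrite in_itv/=; move: k0M h1 h2; lra.
have EFj0 : ae_eq_set (E `\` cyl j0) (F `\` cyl j0).
  apply: ae_eq_set_trans (ae_eq_setDS _ _ _ _ MC EM) _.
  exact: ae_eq_set_sym.
(* E corrected on a null set so as to agree exactly with F off [cyl j0], as [nl_minimal_widen]
   demands. *)
pose E' := (E `&` cyl j0) `|` (F `\` cyl j0).
have mcyl0 := mcyl j0.
have mE' : leb_measurable E' by apply: measurableU;
  [exact: measurableI|exact: measurableD].
have E'F : E' `\` cyl j0 = F `\` cyl j0.
  apply/seteqP; split=> x; first by case=> -[[]|].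
  by move=> [Fx nU]; split=> //; right.
have EE' : ae_eq_set E E'.
  apply: negligibleS EFj0 => x [[Ex nE']|[[[]//|[Fx nU]] nE]].
    have nU : ~ cyl j0 x by move=> Ux; apply: nE'; left.
    by left; split=> // -[Fx _]; apply: nE'; right.
  by right; split=> // -[].
have minE' j : s_minimal s E' (cyl j) by exact: (s_minimal_ae mE mE' (mcyl j)
  EE' (minE j)).
have minF j : (j0 <= j)%N -> s_minimal s F (cyl j).
  move=> j0j; have [_ nlE'] := (s_minimal_nl s mE' (mcyl j)).1 (minE' j).
  have [finE' _] := (s_minimal_nl s mE' (mcyl j)).1 (minE' j).
  have [_ nlF] := (s_minimal_nl s F_measurable (mcyl j0)).1 F_minimal.
  have nlFj := nl_minimal_widen (measurable_pt_kernel s) (@pt_kernel_ge0 R n s)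
    (cylS _ _ j0j) (mcyl j0) (mcyl j) mE' F_measurable E'F nlE' nlF.
  (* Finiteness in the larger cylinder also comes from comparison: [E'] is a competitor for F there
     and has finite perimeter. *)
  apply/s_minimal_nl => //; split=> //; apply: le_lt_trans finE'.
  apply: nlFj => //; rewrite -(setUidr (cylS _ _ j0j)) -!setDDl E'F.
  by [].
split.
  move=> k k0k; have [j kE] := pos_int _ (lt_le_trans k00 k0k).
  by move: k0k; rewrite kE k0E => j0j; exact: (minF j).
apply: (locally_s_minimal_cylinders Omega_open F_measurable) => j.
have [j0j|jj0] := leqP j0 j; first exact: minF.
exact: (s_minimal_sub (cylS _ _ (ltnW jj0)) F_measurable (mcyl j) (mcyl j0)
  F_minimal).
Qed.
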